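(* Let $\mathcal C$ be a category such that for every object $y$ the collection $\mathcal C_y$ of subobjects of $y$ is a finite lattice. Let $F\in\mathrm{Ob}(\mathcal C)$ be of symmetric type $\Phi$. For every $\lambda\le\Phi$, let $\mathcal F_\lambda$ be the vector space of $\mathbb Q$-valued functions on the set $\binom{F}{\lambda}$ of subobjects of $F$ of type $\lambda$. Let $\phi$ be a type such that $\phi\le\Phi$ is a symmetric couple, and let $G=\mathrm{Aut}_{\mathcal C}(F)$. Then there exists a collection of pairwise non-equivalent irreducible $G$-representations $\{\mathcal U_\lambda\}_{\lambda\le\phi}$ (over $\mathbb Q$) such that: (1) $\mathcal F_\phi\simeq\bigoplus_{\lambda\le\phi}\mathcal U_\lambda$. (2) For every $\lambda,\nu\le\phi$, $\langle\mathcal U_\lambda,\mathcal F_\nu\rangle=|\{\lambda\hookrightarrow\nu\}|$; that is, the multiplicity of $\mathcal U_\lambda$ in $\mathcal F_\nu$ is the number of non-equivalent monics from an object of type $\lambda$ to an object of type $\nu$. In particular $\mathcal U_\lambda$ appears in $\mathcal F_\lambda$ with multiplicity one and does not appear in $\mathcal F_\nu$ unless $\lambda\le\nu$.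
   Context: A subobject of an object $y$ of $\mathcal C$ is an equivalence class of monics $i:x\to y$, where $i\sim i'$ ($i':x'\to y$) if there is an isomorphism $\psi:x\to x'$ with $i'\psi=i$; $i\le i'$ if there is a morphism $\psi:x\to x'$ with $i'\psi=i$. The meet and join in the lattice $\mathcal C_y$ are denoted $\wedge,\vee$. The type $\tau(x)$ of an object is its isomorphism class; $\lambda\le\mu$ means that there is a monic from an object of type $\lambda$ to an object of type $\mu$. Two monics $i:x\to y$, $i':x'\to y'$ are equivalent if there are isomorphisms $x\to x'$, $y\to y'$ making the square with $i,i'$ commute; $\{\lambda\hookrightarrow\nu\}$ is the set of equivalence classes of monics from an object of type $\lambda$ to an object of type $\nu$. A type $\phi$ is symmetric if for all objects $f,f'$ of type $\phi$, all monics $x\to f$, $x'\to f'$ and every isomorphism $h:x\to x'$, there is an isomorphism $f\to f'$ making the resulting square commute. For symmetric types $\phi\le\Phi$, $(\Phi,\phi)$ is a symmetric couple if for every object $F$ of type $\Phi$, every subobject $f$ of $F$ of type $\phi$ and every $\lambda\le\phi$: (i) there is a subobject $f'$ of $F$ with $\tau(f')=\phi$ and $\tau(f\wedge f')=\lambda$; (ii) for every subobject $x$ of $F$ with $\tau(x)\le\phi$, the square formed by $x\wedge f$, $x$, $f$, $x\vee f$ and the canonical monics is a pushout in $\mathcal C$ (i.e. $x\vee f$ is the pushout of $x\leftarrow x\wedge f\to f$). $G$ acts on $\binom{F}{\lambda}$ by composition and on $\mathcal F_\lambda$ by $[gh](x)=h(g^{-1}x)$. $\langle\mathcal U,\mathcal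 F\rangle$ denotes the multiplicity of the irreducible representation $\mathcal U$ in $\mathcal F$. *)

(* Defs.v *)
From HB Require Import structures.
From mathcomp Require Import all_boot all_order all_algebra.
From mathcomp Require Import boolp classical_sets cardinality.

Set Implicit Arguments.
Unset Strict Implicit.
Unset Printing Implicit Defensive.

Import Order.TTheory GRing.Theory.

Local Open Scope ring_scope.
Local Open Scope quotient_scope.

Record category := Category {
  obj :> Type;
  hom : obj -> obj -> Type;
  idm : forall x, hom x x;
  mcomp : forall x y z, hom y z -> hom x y -> hom x z;
  comp1m : forall x y (f : hom x y), mcomp (idm y) f = f;
  compm1 : forall x y (f : hom x y), mcomp f (idm x) = f;
  compA : forall w x y z (h : hom y z) (g : hom x y) (f : hom w x),
    mcomp h (mcomp g f) = mcomp (mcomp h g) f }.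

Arguments idm {c} x.
Arguments mcomp {c x y z}.

Notation "g \oc f" := (mcomp g f)
  (at level 40, left associativity, format "g  \oc  f").

Section CategoryDefs.
Context {C : category}.
Implicit Types x y z : C.

Definition is_iso x y (f : hom x y) : Prop :=
  exists2 g : hom y x, g \oc f = idm x & f \oc g = idm y.

Definition is_monic x y (f : hom x y) : Prop :=
  forall z (g h : hom z x), f \oc g = f \oc h -> g = h.

Definition is_pushout m x f j
    (a : hom m x) (b : hom m f) (c : hom x j) (d : hom f j) : Prop :=
  c \oc a = d \oc b /\
  forall z (u : hom x z) (v : hom f z), u \oc a = v \oc b ->
    exists! w : hom j z, w \oc c = u /\ w \oc d = v.

Lemma is_iso_id x : is_iso (idm x).
Proof. by exists (idm x); rewrite comp1m. Qed.

Lemma is_iso_comp x y z (g : hom y z) (f : hom x y) :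
  is_iso g -> is_iso f -> is_iso (g \oc f).
Proof.
move=> [g' g'g gg'] [f' f'f ff']; exists (f' \oc g').
- by rewrite compA -(compA f') g'g compm1.
- by rewrite compA -(compA g) ff' compm1.
Qed.

Lemma iso_monic x y (f : hom x y) : is_iso f -> is_monic f.
Proof.
move=> [f' f'f _] z g h /(congr1 (mcomp f')).
by rewrite !compA f'f !comp1m.
Qed.

Lemma monic_comp x y z (g : hom y z) (f : hom x y) :
  is_monic g -> is_monic f -> is_monic (g \oc f).
Proof. by move=> mg mf w u v; rewrite -!compA => /mg /mf. Qed.

End CategoryDefs.

Section Types.
Variable C : category.

Definition iso_rel : rel {classic C} :=
  fun x y => `[< exists f : @hom C x y, is_iso f >].

Lemma iso_rel_refl : reflexive iso_rel.
Proof. by move=> x; apply/asboolP; exists (idm x); apply: is_iso_id. Qed.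

Lemma iso_rel_sym : symmetric iso_rel.
Proof.
by move=> x y; apply/asboolP/asboolP => -[f [g gf fg]]; exists g; exists f.
Qed.

Lemma iso_rel_trans : transitive iso_rel.
Proof.
move=> y x z /asboolP[f fi] /asboolP[g gi].
by apply/asboolP; exists (g \oc f); apply: is_iso_comp.
Qed.

Canonical iso_equiv := EquivRel iso_rel iso_rel_refl iso_rel_sym iso_rel_trans.

Definition otype : Type := {eq_quot iso_equiv}.
HB.instance Definition _ := Choice.on otype.
HB.instance Definition _ := EqQuotient.on otype.

End Types.

Definition tau {C : category} (x : C) : otype C := \pi_(otype C) (x : {classic C}).

Lemma tauP (C : category) (x y : C) :
  tau x = tau y <-> exists f : hom x y, is_iso f.
Proof.
split; last by move=> fi; apply/eqmodP/asboolP.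
by move/eqmodP => /asboolP.
Qed.

Definition ole {C : category} (l m : otype C) : bool :=
  `[< exists x y (f : @hom C x y), [/\ tau x = l, tau y = m & is_monic f] >].

Definition symmetric_type {C : category} (phi : otype C) : Prop :=
  forall (f f' x x' : C) (i : hom x f) (i' : hom x' f') (h : hom x x'),
    tau f = phi -> tau f' = phi -> is_monic i -> is_monic i' -> is_iso h ->
    exists2 g : hom f f', is_iso g & g \oc i = i' \oc h.

Record monic_to (C : category) (y : C) := MonicTo {
  mdom : C;
  mmor :> hom mdom y;
  mmorP : is_monic mmor }.

Section Subobjects.
Variables (C : category) (y : C).
Local Notation M := {classic monic_to y}.

Definition sub_rel : rel M := fun i i' =>
  `[< exists2 psi : @hom C (mdom i) (mdom i'), is_iso psi & i' \oc psi = i >].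

Lemma sub_rel_refl : reflexive sub_rel.
Proof.
move=> i; apply/asboolP; exists (idm _); first exact: is_iso_id.
exact: compm1.
Qed.

Lemma sub_rel_sym : symmetric sub_rel.
Proof.
suff H i j : sub_rel i j -> sub_rel j i by move=> i j; apply/idP/idP => /H.
move=> /asboolP[f [g gf fg] e]; apply/asboolP; exists g; first by exists f.
by rewrite -e -compA fg compm1.
Qed.

Lemma sub_rel_trans : transitive sub_rel.
Proof.
move=> j i k /asboolP[f fi ef] /asboolP[g gi eg].
apply/asboolP; exists (g \oc f); first exact: is_iso_comp.
by rewrite compA eg ef.
Qed.

Canonical sub_equiv := EquivRel sub_rel sub_rel_refl sub_rel_sym sub_rel_trans.

Definition subobj : Type := {eq_quot sub_equiv}.
HB.instance Definition _ := Choice.on subobj.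
HB.instance Definition _ := EqQuotient.on subobj.

Definition srepr (s : subobj) : monic_to y := repr s.
Definition sdom (s : subobj) : C := mdom (srepr s).

Definition sub_le : rel subobj := fun s t =>
  `[< exists psi : hom (sdom s) (sdom t), srepr t \oc psi = srepr s >].

Lemma sub_le_refl : reflexive sub_le.
Proof. by move=> s; apply/asboolP; exists (idm _); rewrite compm1. Qed.

Lemma sub_le_anti : antisymmetric sub_le.
Proof.
move=> s t /andP[/asboolP[f ef] /asboolP[g eg]].
rewrite -[s]reprK -[t]reprK; apply/eqmodP/asboolP; exists f => //.
exists g; [apply: (@mmorP _ _ (srepr s))|apply: (@mmorP _ _ (srepr t))].
- by rewrite compA eg ef compm1.
- by rewrite compA ef eg compm1.
Qed.

Lemma sub_le_trans : transitive sub_le.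
Proof.
move=> t s u /asboolP[f ef] /asboolP[g eg].
by apply/asboolP; exists (g \oc f); rewrite compA eg.
Qed.

Fact sub_display : Order.disp_t. Proof. exact: Order.Disp tt tt. Qed.

HB.instance Definition _ := Order.Le_isPOrder.Build sub_display subobj
  sub_le_refl sub_le_anti sub_le_trans.

Lemma canon_subproof (s t : subobj) : (s <= t)%O ->
  exists psi : hom (sdom s) (sdom t), srepr t \oc psi = srepr s.
Proof. by move/asboolP. Qed.

(* Unique, as [srepr t] is monic; see [canonP]. *)
Definition canon (s t : subobj) (le_st : (s <= t)%O) : hom (sdom s) (sdom t) :=
  sval (cid (canon_subproof le_st)).

Lemma canonP (s t : subobj) (le_st : (s <= t)%O) :
  srepr t \oc canon le_st = srepr s.
Proof. exact: svalP (cid (canon_subproof le_st)). Qed.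

(* Independent of the representative; see [stau_subobj_of]. *)
Definition stau (s : subobj) : otype C := tau (sdom s).

End Subobjects.

Definition subobj_of {C : category} {x y : C} (i : hom x y) (im : is_monic i) :
  subobj y := \pi_(subobj y) (MonicTo im : {classic monic_to y}).

Lemma stau_subobj_of (C : category) (x y : C) (i : hom x y) (im : is_monic i) :
  stau (subobj_of im) = tau x.
Proof.
have /eqmodP/asboolP[psi psi_iso _] :
  \pi_(subobj y) (repr (subobj_of im)) = subobj_of im by rewrite reprK.
by apply/tauP; exists psi.
Qed.

Record monic_arrow (C : category) := MonicArrow {
  asrc : C;
  atgt : C;
  amor :> hom asrc atgt;
  amorP : is_monic amor }.

Section MonicClasses.
Variable C : category.
Local Notation M := {classic monic_arrow C}.

Definition arrow_rel : rel M := fun i i' =>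
  `[< exists (h : @hom C (asrc i) (asrc i')) (g : @hom C (atgt i) (atgt i')),
        [/\ is_iso h, is_iso g & g \oc i = i' \oc h] >].

Lemma arrow_rel_refl : reflexive arrow_rel.
Proof.
move=> i; apply/asboolP; exists (idm _), (idm _).
by split; [exact: is_iso_id | exact: is_iso_id | rewrite comp1m compm1].
Qed.

Lemma arrow_rel_sym : symmetric arrow_rel.
Proof.
suff H i j : arrow_rel i j -> arrow_rel j i by move=> i j; apply/idP/idP => /H.
move=> /asboolP[h [g [[h' h'h hh'] [g' g'g gg'] e]]].
apply/asboolP; exists h', g'; split; [by exists h | by exists g |].
by rewrite -[LHS]compm1 -hh' !compA -(compA g') -e !compA g'g comp1m.
Qed.

Lemma arrow_rel_trans : transitive arrow_rel.
Proof.
move=> j i k /asboolP[h [g [hi gi e]]] /asboolP[h' [g' [hi' gi' e']]].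
apply/asboolP; exists (h' \oc h), (g' \oc g).
split; [exact: is_iso_comp | exact: is_iso_comp |].
by rewrite -compA e compA e' compA.
Qed.

Canonical arrow_equiv :=
  EquivRel arrow_rel arrow_rel_refl arrow_rel_sym arrow_rel_trans.

Definition monic_class : Type := {eq_quot arrow_equiv}.
HB.instance Definition _ := Choice.on monic_class.
HB.instance Definition _ := EqQuotient.on monic_class.

Definition arepr (m : monic_class) : monic_arrow C := repr m.

Definition hook_pred (l n : otype C) : pred monic_class :=
  fun m => (tau (asrc (arepr m)) == l) && (tau (atgt (arepr m)) == n).

(* The predicate only depends on the class, since equivalent monics have
   isomorphic sources and isomorphic targets. *)
Definition hooks (l n : otype C) : Type := {m : monic_class | hook_pred l n m}.

HB.instance Definition _ l n := Choice.on (hooks l n).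
HB.instance Definition _ l n := SubType.on (hooks l n).

End MonicClasses.

Record flcategory := FLCategory {
  flcat :> category;
  subobj_finite : forall y : flcat, finite_set [set: subobj y]%classic;
  subobj_meet : forall (y : flcat) (s t : subobj y),
    exists m, forall u, (u <= m)%O = ((u <= s) && (u <= t))%O;
  subobj_join : forall (y : flcat) (s t : subobj y),
    exists j, forall u, (j <= u)%O = ((s <= u) && (t <= u))%O }.

Section FiniteSetFinType.
Variables (T : choiceType) (finT : finite_set [set: T]%classic).

Definition fin_enum : seq T := undup (sval (cid ((finite_seqP _).1 finT))).

Lemma mem_fin_enum x : x \in fin_enum.
Proof.
rewrite mem_undup; case: cid => s /= /(congr1 (fun A : set T => A x)) e.
have : [set: T]%classic x by []. by rewrite e.
Qed.

Lemma fin_enumP : Finite.axiom fin_enum.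
Proof. by move=> x; rewrite count_uniq_mem ?undup_uniq // mem_fin_enum. Qed.

Definition fin_unpickle (n : nat) : option T := onth fin_enum n.

Lemma fin_pickleK : pcancel (fun x => index x fin_enum) fin_unpickle.
Proof.
move=> x; rewrite /fin_unpickle onthE (nth_map x) ?index_mem ?mem_fin_enum //.
by rewrite nth_index // mem_fin_enum.
Qed.

End FiniteSetFinType.

Section SubobjLattice.
Variables (C : flcategory) (y : C).
Implicit Types s t u : subobj y.

HB.instance Definition _ := Choice_isCountable.Build (subobj y)
  (fin_pickleK (subobj_finite y)).
HB.instance Definition _ := isFinite.Build (subobj y)
  (fin_enumP (subobj_finite y)).

Definition sub_meet s t : subobj y := sval (cid (subobj_meet s t)).
Definition sub_join s t : subobj y := sval (cid (subobj_join s t)).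

Lemma sub_meetP s t u : (s <= sub_meet t u)%O = ((s <= t) && (s <= u))%O.
Proof. exact: svalP (cid (subobj_meet t u)) s. Qed.

Lemma sub_joinP s t u : (sub_join s t <= u)%O = ((s <= u) && (t <= u))%O.
Proof. exact: svalP (cid (subobj_join s t)) u. Qed.

HB.instance Definition _ := Order.POrder_MeetJoin_isLattice.Build
  sub_display (subobj y) sub_meetP sub_joinP.

End SubobjLattice.

Definition symmetric_couple {C : flcategory} (Phi phi : otype C) : Prop :=
  [/\ symmetric_type Phi, symmetric_type phi, ole phi Phi &
   forall (F : C) (f : subobj F) (l : otype C),
     tau F = Phi -> stau f = phi -> ole l phi ->
     (exists f' : subobj F, stau f' = phi /\ stau (f `&` f')%O = l) /\
     (forall x : subobj F, ole (stau x) phi ->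
        is_pushout (canon (leIl x f)) (canon (leIr f x))
                   (canon (leUl x f)) (canon (leUr f x)))].

Section TypesBelow.
Variables (C : flcategory) (phi : otype C).

Definition types_le : Type := {l : otype C | ole l phi}.
HB.instance Definition _ := Choice.on types_le.
HB.instance Definition _ := SubType.on types_le.

Lemma types_le_finite : finite_set [set: types_le]%classic.
Proof.
pose y : C := repr phi.
have yE : tau y = phi by rewrite /tau reprK.
have stauP (s : subobj y) : ole (stau s) phi.
  by apply/asboolP; exists (sdom s), y, (srepr s); split=> //; apply: mmorP.
pose f (s : subobj y) : types_le := exist _ (stau s) (stauP s).
apply: (sub_finite_set _ (finite_image f (subobj_finite y))) => -[l lphi] _ /=.
have /asboolP[x [z [i [xl zphi im]]]] := lphi.
have [g gi] : exists g : hom z y, is_iso g by apply/tauP; rewrite yE.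
have gim : is_monic (g \oc i) by apply: monic_comp im; apply: iso_monic.
exists (subobj_of gim) => //; apply: val_inj; rewrite /= stau_subobj_of.
exact: xl.
Qed.

HB.instance Definition _ := Choice_isCountable.Build types_le
  (fin_pickleK types_le_finite).
HB.instance Definition _ := isFinite.Build types_le
  (fin_enumP types_le_finite).

End TypesBelow.

Section HooksFinite.
Variables (C : flcategory) (l n : otype C).

Lemma hooks_finite : finite_set [set: hooks l n]%classic.
Proof.
pose y : C := repr n.
have yE : tau y = n by rewrite /tau reprK.
pose f (s : subobj y) : monic_class C :=
  \pi_(monic_class C) (MonicArrow (@mmorP _ _ (srepr s)) : {classic _}).
have fin := finite_image f (subobj_finite y).
have fin' := finite_image (fun m => insub m : option (hooks l n)) fin.
suff sub : ([set: hooks l n] `<=` Some @^-1`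
    ((fun m => insub m : option (hooks l n)) @` (f @` [set: subobj y])))%classic.
  apply: (sub_finite_set sub); apply: finite_preimage fin'.
  by move=> a b _ _ [].
move=> m _ /=; exists (val m); last by rewrite valK.
have /andP[_ /eqP tn] := valP m.
set i := arepr (val m) in tn.
have [g gi] : exists g : hom (atgt i) y, is_iso g by apply/tauP; rewrite yE.
have gim : is_monic (g \oc i).
  by apply: monic_comp (@amorP _ i); apply: iso_monic.
exists (subobj_of gim) => //.
rewrite -[RHS]reprK; apply/esym/eqmodP/asboolP.
have /eqmodP/asboolP[psi psi_iso e] :
  subobj_of gim = \pi_(subobj y) (repr (subobj_of gim)) by rewrite reprK.
by exists psi, g; split.
Qed.

HB.instance Definition _ := Choice_isCountable.Build (hooks l n)
  (fin_pickleK hooks_finite).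
HB.instance Definition _ := isFinite.Build (hooks l n)
  (fin_enumP hooks_finite).

End HooksFinite.

Record aut (C : category) (x : C) := MkAut {
  aut_fwd :> hom x x;
  aut_bwd : hom x x;
  aut_fwdK : aut_bwd \oc aut_fwd = idm x;
  aut_bwdK : aut_fwd \oc aut_bwd = idm x }.

Section AutGroup.
Variables (C : category) (x : C).
Implicit Types g h : aut x.

HB.instance Definition _ := gen_eqMixin (aut x).
HB.instance Definition _ := gen_choiceMixin (aut x).

Lemma aut_inj g h : aut_fwd g = aut_fwd h -> g = h.
Proof.
case: g h => [f b bf fb] [f' b' b'f' f'b'] /= e; subst f'.
have e : b = b' by rewrite -[b]comp1m -b'f' -compA fb compm1.
by subst b'; congr MkAut; exact: Prop_irrelevance.
Qed.

Lemma aut_is_iso g : is_iso g.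
Proof. by exists (aut_bwd g); [exact: aut_fwdK | exact: aut_bwdK]. Qed.

Definition aut_one : aut x := MkAut (comp1m (idm x)) (comp1m (idm x)).

Definition aut_inv g : aut x := MkAut (aut_bwdK g) (aut_fwdK g).

Lemma aut_mul_subproof1 g h :
  (aut_bwd h \oc aut_bwd g) \oc (aut_fwd g \oc aut_fwd h) = idm x.
Proof. by rewrite compA -(compA (aut_bwd h)) aut_fwdK compm1 aut_fwdK. Qed.

Lemma aut_mul_subproof2 g h :
  (aut_fwd g \oc aut_fwd h) \oc (aut_bwd h \oc aut_bwd g) = idm x.
Proof. by rewrite compA -(compA (aut_fwd g)) aut_bwdK compm1 aut_bwdK. Qed.

Definition aut_mul g h : aut x :=
  MkAut (aut_mul_subproof1 g h) (aut_mul_subproof2 g h).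

Lemma aut_mulA : associative aut_mul.
Proof. by move=> f g h; apply: aut_inj; exact: compA. Qed.
Lemma aut_mul1 : left_id aut_one aut_mul.
Proof. by move=> g; apply: aut_inj; exact: comp1m. Qed.
Lemma aut_mulr1 : right_id aut_one aut_mul.
Proof. by move=> g; apply: aut_inj; exact: compm1. Qed.
Lemma aut_mulV : left_inverse aut_one aut_inv aut_mul.
Proof. by move=> g; apply: aut_inj; exact: aut_fwdK. Qed.
Lemma aut_mulVr : right_inverse aut_one aut_inv aut_mul.
Proof. by move=> g; apply: aut_inj; exact: aut_bwdK. Qed.

HB.instance Definition _ := isGroup.Build (aut x)
  aut_mulA aut_mul1 aut_mulr1 aut_mulV aut_mulVr.

End AutGroup.

(* Finite-dimensional representations; the group may be infinite. *)
Record representation (G : groupType) := Representation {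
  rcar :> vectType rat;
  ract : G -> 'End(rcar);
  ract1 : ract 1%g = \1%VF;
  ractM : forall g h, ract (g * h)%g = (ract g \o ract h)%VF }.

Arguments ract {G} r g.

Section Representations.
Variable G : groupType.
Implicit Types V W : representation G.

Definition irreducible V : Prop :=
  \dim {:V} != 0 /\
  forall W : {vspace V}, (forall g, (ract V g @: W <= W)%VS) ->
    W = 0%VS \/ W = fullv.

Definition rep_iso V W : Prop :=
  exists2 f : 'Hom(V, W), bijective f &
    forall g v, f (ract V g v) = ract W g (f v).

Import VectorInternalTheory.

Section DirectSum.
Variables (I : finType) (V : I -> representation G).

(* As I is finite, the direct sum is carried by all dependent functions. *)
Definition dsum_type : Type := {dffun forall i, V i}.
HB.instance Definition _ := Choice.on dsum_type.

Definition dsum_of (h : forall i, V i) : dsum_type := [ffun i => h i].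

Definition dsum_zero : dsum_type := dsum_of (fun i => 0).
Definition dsum_opp (u : dsum_type) : dsum_type := dsum_of (fun i => - u i).
Definition dsum_add (u v : dsum_type) : dsum_type :=
  dsum_of (fun i => u i + v i).
Definition dsum_scale (a : rat) (u : dsum_type) : dsum_type :=
  dsum_of (fun i => a *: u i).

Lemma dsum_addA : associative dsum_add.
Proof. by move=> u v w; apply/ffunP=> i; rewrite !ffunE addrA. Qed.
Lemma dsum_addC : commutative dsum_add.
Proof. by move=> u v; apply/ffunP=> i; rewrite !ffunE addrC. Qed.
Lemma dsum_add0 : left_id dsum_zero dsum_add.
Proof. by move=> u; apply/ffunP=> i; rewrite !ffunE add0r. Qed.
Lemma dsum_addN : left_inverse dsum_zero dsum_opp dsum_add.
Proof. by move=> u; apply/ffunP=> i; rewrite !ffunE addNr. Qed.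

HB.instance Definition _ := GRing.isZmodule.Build dsum_type
  dsum_addA dsum_addC dsum_add0 dsum_addN.

Lemma dsum_scaleA a b (u : dsum_type) :
  dsum_scale a (dsum_scale b u) = dsum_scale (a * b) u.
Proof. by apply/ffunP=> i; rewrite !ffunE scalerA. Qed.
Lemma dsum_scale1 : left_id 1 dsum_scale.
Proof. by move=> u; apply/ffunP=> i; rewrite !ffunE scale1r. Qed.
Lemma dsum_scaleDr : right_distributive dsum_scale +%R.
Proof. by move=> a u v; apply/ffunP=> i; rewrite !ffunE scalerDr. Qed.
Lemma dsum_scaleDl (u : dsum_type) :
  {morph dsum_scale^~ u : a b / a + b}.
Proof. by move=> a b; apply/ffunP=> i; rewrite !ffunE scalerDl. Qed.

HB.instance Definition _ := GRing.Zmodule_isLmodule.Build rat dsum_type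
  dsum_scaleA dsum_scale1 dsum_scaleDr dsum_scaleDl.

Lemma dsumD (u v : dsum_type) i : (u + v) i = u i + v i.
Proof. exact: ffunE. Qed.
Lemma dsumZ a (u : dsum_type) i : (a *: u) i = a *: u i.
Proof. exact: ffunE. Qed.

Lemma dsum_vect_iso :
  Vector.axiom (\sum_(k < #|I|) dim (V (enum_val k))) dsum_type.
Proof.
pose f (u : dsum_type) :=
  \mxrow_(k < #|I|) (v2r (u (enum_val k)) : 'rV[rat]_(dim (V (enum_val k)))).
exists f.
  move=> a u v; apply/rowP => j; rewrite !mxE dsumD dsumZ linearP.
  by rewrite !mxE.
pose g (r : 'rV[rat]_(\sum_(k < #|I|) dim (V (enum_val k)))) : dsum_type :=
  dsum_of (fun i => eq_rect _ (fun j => V j : Type)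
    (r2v (submxrow r (enum_rank i))) _ (enum_rankK i)).
exists g => [u|r].
  apply/ffunP => i; rewrite ffunE mxrowK v2rK.
  have transp j (e : j = i) : eq_rect j (fun j => V j : Type) (u j) i e = u i.
    by case: i / e.
  exact: transp.
rewrite -[RHS]submxrowK; apply/eq_mxrowP => k; rewrite ffunE.
have transp k' (e : enum_val k' = enum_val k) : k' = k ->
    v2r (eq_rect _ (fun j => V j : Type) (r2v (submxrow r k')) _ e)
    = submxrow r k.
  by move=> ek; subst k'; rewrite (Prop_irrelevance e erefl) /= r2vK.
by apply: transp; exact: enum_valK.
Qed.

HB.instance Definition _ :=
  Lmodule_hasFinDim.Build rat dsum_type dsum_vect_iso.

Definition dsum_act_fun (g : G) (u : dsum_type) : dsum_type :=
  dsum_of (fun i => ract (V i) g (u i)).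

Lemma dsum_act_linear g : linear (dsum_act_fun g).
Proof.
move=> a u v; apply/ffunP => i; rewrite ffunE.
have -> : (a *: u + v) i = a *: u i + v i by rewrite dsumD dsumZ.
rewrite linearP; apply/esym; etransitivity; first exact: dsumD.
by rewrite dsumZ !ffunE.
Qed.

HB.instance Definition _ g := GRing.isLinear.Build rat dsum_type dsum_type _
  (dsum_act_fun g) (dsum_act_linear g).

Definition dsum_act (g : G) : 'End(dsum_type) := linfun (dsum_act_fun g).

Lemma dsum_act1 : dsum_act 1%g = \1%VF.
Proof.
apply/lfunP => u; rewrite lfunE id_lfunE; apply/ffunP => i.
by rewrite ffunE ract1 id_lfunE.
Qed.

Lemma dsum_actM g h : dsum_act (g * h)%g = (dsum_act g \o dsum_act h)%VF.
Proof.
apply/lfunP => u; rewrite comp_lfunE !lfunE; apply/ffunP => i.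
by rewrite !ffunE ractM comp_lfunE.
Qed.

Definition dsum : representation G := Representation dsum_act1 dsum_actM.

End DirectSum.

(* [has_multiplicity U V m]: V is a direct sum of irreducibles, exactly m of
   which are isomorphic to U. *)
Definition has_multiplicity (U V : representation G) (m : nat) : Prop :=
  exists (n : nat) (W : 'I_n -> representation G),
    [/\ forall i, irreducible (W i), rep_iso V (dsum W) &
        #|[set i | `[< rep_iso U (W i) >]]| = m].

End Representations.

Definition binom {C : category} (F : C) (l : otype C) : Type :=
  {s : subobj F | stau s == l}.

HB.instance Definition _ (C : category) (F : C) l := Choice.on (@binom C F l).
HB.instance Definition _ (C : category) (F : C) l := SubType.on (@binom C F l).
HB.instance Definition _ (C : flcategory) (F : C) l := Finite.on (@binom C F l).

Section FunctionRepr.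
Variables (C : flcategory) (F : C).
Implicit Types (g h : aut F) (s : subobj F).

Lemma aut_comp_monic g (i : monic_to F) : is_monic (g \oc i).
Proof. by apply: monic_comp (@mmorP _ _ i); apply/iso_monic/aut_is_iso. Qed.

Definition sub_act g s : subobj F := subobj_of (@aut_comp_monic g (srepr s)).

Lemma sub_act_stau g s : stau (sub_act g s) = stau s.
Proof. exact: stau_subobj_of. Qed.

Lemma sub_act1 s : sub_act 1%g s = s.
Proof.
rewrite -[RHS]reprK; apply/eqmodP/asboolP.
exists (idm _); first exact: is_iso_id.
by rewrite compm1 /= comp1m.
Qed.

Lemma sub_actM g h s : sub_act (g * h)%g s = sub_act g (sub_act h s).
Proof.
have /eqmodP/asboolP[psi psi_iso /= e] :
  sub_act h s = \pi_(subobj F) (repr (sub_act h s)) by rewrite reprK.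
apply/eqmodP/asboolP; exists psi => //=.
by rewrite -compA e compA.
Qed.

Section Binom.
Variable l : otype C.

Lemma binom_act_subproof g (x : binom F l) : stau (sub_act g (val x)) == l.
Proof. by rewrite sub_act_stau (valP x). Qed.

Definition binom_act g (x : binom F l) : binom F l :=
  exist _ (sub_act g (val x)) (binom_act_subproof g x).

Definition fun_type : vectType rat := {ffun binom F l -> rat^o}.

Definition fun_act_fun g (h : fun_type) : fun_type :=
  [ffun x => h (binom_act g^-1%g x)].

Lemma fun_act_linear g : linear (fun_act_fun g).
Proof. by move=> a u v; apply/ffunP => x; rewrite !ffunE. Qed.

HB.instance Definition _ g := GRing.isLinear.Build rat fun_type fun_type _
  (fun_act_fun g) (fun_act_linear g).

Definition fun_act g : 'End(fun_type) := linfun (fun_act_fun g).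

Lemma fun_act1 : fun_act 1%g = \1%VF.
Proof.
apply/lfunP => u; rewrite lfunE id_lfunE; apply/ffunP => x.
by rewrite ffunE invg1; congr (u _); apply: val_inj; exact: sub_act1.
Qed.

Lemma fun_actM g h : fun_act (g * h)%g = (fun_act g \o fun_act h)%VF.
Proof.
apply/lfunP => u; rewrite comp_lfunE !lfunE; apply/ffunP => x.
by rewrite !ffunE invgM; congr (u _); apply: val_inj; exact: sub_actM.
Qed.

Definition fun_rep : representation (aut F) := Representation fun_act1 fun_actM.

End Binom.

End FunctionRepr.

Arguments fun_rep {C} F l.

(* Main.v *)
From HB Require Import structures.
From mathcomp Require Import all_boot all_order all_algebra.
From mathcomp Require Import boolp.
Require Import Defs.

Set Implicit Arguments.
Unset Strict Implicit.
Unset Printing Implicit Defensive.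

Import Order.TTheory GRing.Theory Num.Theory.

Local Open Scope ring_scope.
Local Open Scope quotient_scope.

(** Write G for the automorphism group of F, F_n for the representation on
    functions on the subobjects of F of type n, and l, n for types below phi.

    Intertwiners from F_b to F_a are the G-invariant kernels on pairs of
    subobjects of types a and b; here they are square matrices indexed by all
    subobjects of F.  If f has type phi and x has type n, the pushout condition
    and the symmetry of phi and of the type of F show that the G-orbit of
    (x, f) is determined by the class of the monic x /\ f -> x
    ([meet_orbit]), and the existence of an f' of type phi meeting f in
    any type below phi shows that every class of monics into an object of type
    n occurs ([meet_surj]).  Hence the kernels [meet_mx m],
    which count the y <= x /\ f such that y -> x has class m, form a basis of
    Hom_G(F_phi, F_n): they are triangular with respect to the orbit indicators
    ([meet_mx_indep], [meet_mx_span]).  Each of them factors through F_l, where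
    l is the source of m, as an inclusion kernel followed by the restriction
    kernel [down_mx l] =: T_l from F_phi to F_l.

    For n = phi there is one class for each l, and the basis consists of the
    kernels c_l = T_l^T T_l.  The algebra End_G(F_phi) is made of symmetric
    matrices, so it is commutative, and the span of the c_k with k <= l is an
    ideal ([spanf_ideal]).  The Gram-Schmidt process for the trace form,
    applied to the c_l along the order of types, therefore yields common
    eigenvectors q_l of the regular representation of this algebra
    ([gram_scal]); their eigenvalues are rational, so the algebra splits over
    rat.  Suitable multiples p_l of the q_l are orthogonal idempotents with sum
    the identity, and U_l is the image of p_l in F_phi.

    Finally T_l q_l is a nonzero multiple of T_l up to lower terms, so that the
    products of [meet_mx m] with p_l, for m from l to n, form a basis of
    Hom_G(U_l, F_n) ([primitive_idempotents], [hom_basis_indep],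
    [hom_basis_span]).  For n = phi this space is a line, which gives
    End_G(U_l) = rat, the irreducibility of U_l and the absence of isomorphisms
    between distinct U_l.  As F_n is completely reducible and End_G(U_l) = rat,
    the multiplicity of U_l in F_n is the dimension of Hom_G(U_l, F_n)
    ([multiplicity_dim_hom]), that is, the number of classes from l to n. *)

(** * Monics, subobjects and classes of inclusions *)

Local Arguments mmorP {C y} m [z g h] _.
Local Arguments amorP {C} m [z g h] _.
Local Arguments iso_monic {C x y f} _ [z g h] _.
Local Arguments monic_comp {C x y z g f} _ _ [z0 g0 h] _ : rename.

Section Monics.
Variable C : category.

Lemma monic_of_comp (x y z : C) (g : hom y z) (f : hom x y) :
  is_monic (g \oc f) -> is_monic f.
Proof. by move=> gf_monic w u v e; apply: gf_monic; rewrite -!compA e. Qed.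

Lemma subobj_eqP (y : C) (i j : monic_to y) :
  \pi_(subobj y) (i : {classic monic_to y}) =
    \pi_(subobj y) (j : {classic monic_to y}) <->
  exists2 psi : hom (mdom i) (mdom j), is_iso psi & j \oc psi = i.
Proof. by split=> [/eqmodP/asboolP|H] //; apply/eqmodP/asboolP. Qed.

Lemma srepr_of (x y : C) (i : hom x y) (im : is_monic i) :
  exists2 psi : hom (sdom (subobj_of im)) x,
    is_iso psi & i \oc psi = srepr (subobj_of im).
Proof.
have /subobj_eqP : \pi_(subobj y) (repr (subobj_of im)) = subobj_of im.
  by rewrite reprK.
by [].
Qed.

Lemma subobj_of_srepr (y : C) (s : subobj y) :
  subobj_of (mmorP (srepr s)) = s.
Proof.
by rewrite -[RHS]reprK; apply/subobj_eqP; exists (idm _);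
  [exact: is_iso_id|exact: compm1].
Qed.

Lemma monic_class_eqP (i j : monic_arrow C) :
  \pi_(monic_class C) (i : {classic monic_arrow C}) =
    \pi_(monic_class C) (j : {classic monic_arrow C}) <->
  exists (h : hom (asrc i) (asrc j)) (g : hom (atgt i) (atgt j)),
    [/\ is_iso h, is_iso g & g \oc i = j \oc h].
Proof. by split=> [/eqmodP/asboolP|H] //; apply/eqmodP/asboolP. Qed.

Lemma canon_monic (y : C) (s t : subobj y) (le_st : (s <= t)%O) :
  is_monic (canon le_st).
Proof.
by apply: (@monic_of_comp _ _ _ (srepr t)); rewrite canonP; apply: mmorP.
Qed.

Arguments canon_monic {y s t} le_st [z g h] _.

Lemma subobj_of_comp (a F : C) (x : subobj F) (i : hom a (sdom x)) :
  is_monic i -> exists s : subobj F, stau s = tau a /\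
    exists2 psi : hom (sdom s) a, is_iso psi & srepr x \oc i \oc psi = srepr s.
Proof.
move=> im; have xm := monic_comp (mmorP (srepr x)) im.
exists (subobj_of xm); split; first exact: stau_subobj_of.
exact: srepr_of.
Qed.

Lemma sub_leP (F : C) (y x : subobj F) (i : hom (sdom y) (sdom x)) :
  srepr x \oc i = srepr y -> (y <= x)%O.
Proof. by move=> e; apply/asboolP; exists i. Qed.

(** The class of the canonical monic y -> x when y <= x; the value in the other
    case is irrelevant. *)
Definition incl_class (F : C) (y x : subobj F) : monic_class C :=
  if pselect (y <= x)%O is left le_yx
  then \pi_(monic_class C)
         (MonicArrow (canon_monic le_yx) : {classic monic_arrow C})
  else \pi_(monic_class C)
         (MonicArrow (iso_monic (is_iso_id (sdom y)))
           : {classic monic_arrow C}).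

Lemma incl_classE (F : C) (y x : subobj F) (le_yx : (y <= x)%O) :
  incl_class y x = \pi_(monic_class C)
         (MonicArrow (canon_monic le_yx) : {classic monic_arrow C}).
Proof.
by rewrite /incl_class; case: pselect => // le;
  rewrite (Prop_irrelevance le le_yx).
Qed.

Lemma hook_pred_pi (i : monic_arrow C) :
  hook_pred (tau (asrc i)) (tau (atgt i))
    (\pi_(monic_class C) (i : {classic monic_arrow C})).
Proof.
set m := \pi_ _ _.
have /monic_class_eqP[h [g [hi gi _]]] :
    \pi_(monic_class C) (repr m) =
    \pi_(monic_class C) (i : {classic monic_arrow C}).
  by rewrite reprK.
by apply/andP; split; apply/eqP/tauP; [exists h|exists g].
Qed.

Lemma incl_class_hook (F : C) (y x : subobj F) :
  (y <= x)%O -> hook_pred (stau y) (stau x) (incl_class y x).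
Proof. by move=> le_yx; rewrite (incl_classE le_yx); apply: hook_pred_pi. Qed.

Lemma hook_pred_uniq (l n l' n' : otype C) (m : monic_class C) :
  hook_pred l n m -> hook_pred l' n' m -> l = l' /\ n = n'.
Proof. by move=> /andP[/eqP<- /eqP<-] /andP[/eqP<- /eqP<-]. Qed.

End Monics.

Local Arguments canon_monic {C y s t} le_st [z g h] _.

(** * The action of the automorphism group on subobjects *)

Section SubAct.
Variables (C : flcategory) (F : C).
Implicit Types (g : aut F) (x y z s t : subobj F).

Lemma sub_act_eqP g s t :
  sub_act g s = t <->
  exists2 psi : hom (sdom s) (sdom t),
    is_iso psi & srepr t \oc psi = g \oc srepr s.
Proof.
rewrite -{1}[t]subobj_of_srepr; split; first by move/subobj_eqP.
by move=> e; apply/subobj_eqP.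
Qed.

Lemma sub_actK g : cancel (sub_act g) (sub_act g^-1%g).
Proof. by move=> s; rewrite -sub_actM mulVg sub_act1. Qed.

Lemma sub_actKV g : cancel (sub_act g^-1%g) (sub_act g).
Proof. by move=> s; rewrite -sub_actM mulgV sub_act1. Qed.

Lemma sub_act_inj g : injective (sub_act g).
Proof. exact: can_inj (sub_actK g). Qed.

Lemma sub_act_homo g : {homo sub_act g : y x / (y <= x)%O}.
Proof.
move=> y x le_yx.
have [h [h' h'h hh'] eh] := (sub_act_eqP g y (sub_act g y)).1 erefl.
have [k _ ek] := (sub_act_eqP g x (sub_act g x)).1 erefl.
apply: (@sub_leP _ _ _ _ (k \oc canon le_yx \oc h')).
by rewrite !compA ek -(compA g) canonP -eh -compA hh' compm1.
Qed.

Lemma sub_act_le g y x : (sub_act g y <= sub_act g x)%O = (y <= x)%O.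
Proof.
apply/idP/idP; last exact: sub_act_homo.
by move/(sub_act_homo g^-1%g); rewrite !sub_actK.
Qed.

Lemma sub_act_meet g x y :
  sub_act g (x `&` y)%O = (sub_act g x `&` sub_act g y)%O.
Proof.
apply/le_anti; rewrite lexI !sub_act_le leIl leIr /=.
by rewrite -[X in (X <= _)%O](sub_actKV g) sub_act_le lexI
  -!(sub_act_le g _ x) -!(sub_act_le g _ y) sub_actKV leIl leIr.
Qed.

Hypothesis symF : symmetric_type (tau F).

(** For an object of symmetric type, equivalence of inclusions y -> x is
    conjugacy of the pairs (y, x) under the automorphism group. *)
Lemma incl_class_eqP y x y' x' : (y <= x)%O -> (y' <= x')%O ->
  incl_class y x = incl_class y' x' <->
  exists g, sub_act g y = y' /\ sub_act g x = x'.
Proof.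
move=> le_yx le_yx'; rewrite (incl_classE le_yx) (incl_classE le_yx'); split.
  move=> /monic_class_eqP/= [h [k [hi ki e]]].
  have [g gi eg] := symF erefl erefl (mmorP (srepr x)) (mmorP (srepr x')) ki.
  have [g' gg' g'g] := gi.
  pose a := MkAut gg' g'g; exists a; split.
    apply/sub_act_eqP; exists h => //=.
    by rewrite -(canonP le_yx) -(canonP le_yx') -compA -e !compA eg.
  by apply/sub_act_eqP; exists k.
case=> g [/sub_act_eqP[h hi eh] /sub_act_eqP[k ki ek]].
apply/monic_class_eqP; exists h, k; split=> //=.
apply: (mmorP (srepr x')).
by rewrite !compA ek canonP eh -compA canonP.
Qed.

Lemma stau_transitive s t : stau s = stau t -> exists g, sub_act g s = t.
Proof.
move=> /tauP[k ki].
have [g gi eg] := symF erefl erefl (mmorP (srepr s)) (mmorP (srepr t)) ki.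
have [g' gg' g'g] := gi; exists (MkAut gg' g'g).
by apply/sub_act_eqP; exists k.
Qed.

Lemma incl_class_act g y x : (y <= x)%O ->
  incl_class (sub_act g y) (sub_act g x) = incl_class y x.
Proof.
move=> le_yx; apply/esym/incl_class_eqP; rewrite ?sub_act_le //.
by exists g.
Qed.

Lemma incl_class_surj x (l : otype C) (m : monic_class C) :
  hook_pred l (stau x) m ->
  exists y, [/\ (y <= x)%O, incl_class y x = m & stau y = l].
Proof.
move=> /andP[/eqP tl /eqP tn].
set i := arepr m in tl tn.
have /tauP[th thi] := tn.
have [s [ts [psi psii e]]] :=
  subobj_of_comp (monic_comp (iso_monic thi) (amorP i)).
have le : (s <= x)%O.
  by apply: (@sub_leP _ _ _ _ (th \oc i \oc psi)); rewrite -e !compA.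
exists s; split; rewrite ?ts //.
rewrite (incl_classE le) -[RHS]reprK; apply/esym/monic_class_eqP.
have [psi' p'p pp'] := psii.
exists psi', th; split=> //=; first by exists psi.
apply: (mmorP (srepr x)).
by rewrite !compA canonP -e -!compA pp' compm1.
Qed.

(** The automorphism carrying x to y permutes the finite set of subobjects, so
    x and y have equally many subobjects below them. *)
Lemma eq_of_stau y x : (y <= x)%O -> stau y = stau x -> y = x.
Proof.
move=> le_yx /esym/stau_transitive[g gxy]; apply/eqP.
rewrite eq_le le_yx /=.
have : [set s : subobj F | (s <= y)%O] == [set s | (s <= x)%O].
  rewrite eqEcard; apply/andP; split.
    by apply/subsetP=> s; rewrite !inE => /le_trans; apply.
  rewrite -(card_imset _ (@sub_act_inj g)); apply/subset_leq_card/subsetP.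
  by move=> _ /imsetP[s + ->]; rewrite !inE -gxy sub_act_le.
by move=> /eqP/setP/(_ x); rewrite !inE lexx.
Qed.

Lemma stau_le s t : (s <= t)%O -> ole (stau s) (stau t).
Proof.
move=> le_st; apply/asboolP; exists (sdom s), (sdom t), (canon le_st).
by split=> //; apply: canon_monic.
Qed.

Lemma ole_sub x (l : otype C) : ole l (stau x) ->
  exists2 y, (y <= x)%O & stau y = l.
Proof.
move=> /asboolP[a [b [i [al bx im]]]].
have /tauP[th thi] := bx.
have [s [ts [psi psii e]]] := subobj_of_comp (monic_comp (iso_monic thi) im).
exists s; last by rewrite ts.
by apply: (@sub_leP _ _ _ _ (th \oc i \oc psi)); rewrite -e !compA.
Qed.

Lemma ole_sub_top (l : otype C) : ole l (tau F) ->
  exists y : subobj F, stau y = l.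
Proof.
move=> /asboolP[a [b [i [al /tauP[th thi] im]]]].
have xm : is_monic (th \oc i) by exact: monic_comp (iso_monic thi) im.
by exists (subobj_of xm); rewrite stau_subobj_of.
Qed.

End SubAct.

Lemma ole_refl (C : category) (l : otype C) : ole l l.
Proof.
apply/asboolP; exists (repr l), (repr l), (idm _).
by split; rewrite ?/tau ?reprK //; apply/iso_monic/is_iso_id.
Qed.

Lemma ole_trans (C : category) (l m n : otype C) :
  ole l m -> ole m n -> ole l n.
Proof.
move=> /asboolP[a [b [i [<- bm im]]]] /asboolP[c [d [j [cm <- jm]]]].
have /tauP[th thi] : tau b = tau c by rewrite bm cm.
apply/asboolP; exists a, d, (j \oc (th \oc i)); split=> //.
by apply: monic_comp => //; apply: monic_comp => //; apply: iso_monic.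
Qed.

(** * Orbits on pairs of subobjects in a symmetric couple *)

Section Couple.
Variables (C : flcategory) (F : C) (phi : otype C).
Hypothesis couple : symmetric_couple (tau F) phi.
Implicit Types (g : aut F) (x y z s t f : subobj F).

Let symF : symmetric_type (tau F). Proof. by case: couple. Qed.
Let symphi : symmetric_type phi. Proof. by case: couple. Qed.
Let le_phi : ole phi (tau F). Proof. by case: couple. Qed.

Lemma couple_pushout f x : stau f = phi -> ole (stau x) phi ->
  is_pushout (canon (leIl x f)) (canon (leIr f x))
             (canon (leUl x f)) (canon (leUr f x)).
Proof.
move=> tf tx; case: couple => _ _ _ /(_ F f (stau x) erefl tf tx)[_].
exact.
Qed.

(** As phi is symmetric, an inclusion into an object of type phi is determined
    up to equivalence by the type of its source. *)
Lemma incl_class_phi y y' f f' : (y <= f)%O -> (y' <= f')%O ->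
  stau f = phi -> stau f' = phi -> stau y = stau y' ->
  incl_class y f = incl_class y' f'.
Proof.
move=> le le' tf tf' /tauP[h hi].
rewrite (incl_classE le) (incl_classE le'); apply/monic_class_eqP => /=.
have [g gi e] := symphi tf tf' (canon_monic le) (canon_monic le') hi.
by exists h, g.
Qed.

(** The automorphism fixing x and carrying f to f' extends the isomorphism
    between the pushouts x \/ f and x \/ f' induced by an isomorphism from f
    to f' over their common meet with x. *)
Lemma meet_fix x f f' : stau f = phi -> stau f' = phi -> ole (stau x) phi ->
  (x `&` f = x `&` f')%O -> exists g, sub_act g x = x /\ sub_act g f = f'.
Proof.
move=> tf tf' tx e.
have [z ez ez'] : exists2 z, z = (x `&` f)%O & z = (x `&` f')%O.
  by exists (x `&` f)%O.
have P := couple_pushout tf tx; have P' := couple_pushout tf' tx.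
have zx : (z <= x)%O by rewrite ez leIl.
have zf : (z <= f)%O by rewrite ez leIr.
have zf' : (z <= f')%O by rewrite ez' leIr.
move: (leIl x f) (leIr f x) (leIl x f') (leIr f' x) P P'.
rewrite -!ez -!ez' => zx1 zf1 zx2 zf2.
rewrite (Prop_irrelevance zx1 zx) (Prop_irrelevance zx2 zx).
rewrite (Prop_irrelevance zf1 zf) (Prop_irrelevance zf2 zf').
move=> [c1 u1] [c2 u2].
(* By symmetry of phi, the identity of z extends to an isomorphism f -> f'. *)
have [th thi eth] :=
  symphi tf tf' (canon_monic zf) (canon_monic zf') (is_iso_id _).
rewrite compm1 in eth.
have [th' th'th thth'] := thi.
have eth' : th' \oc canon zf' = canon zf by rewrite -eth compA th'th comp1m.
have [w [[w1 w2] _]] := u1 _ (canon (leUl x f')) (canon (leUr f' x) \oc th)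
  (etrans c2 (etrans (congr1 _ (esym eth)) (compA _ _ _))).
have [w' [[w1' w2'] _]] := u2 _ (canon (leUl x f)) (canon (leUr f x) \oc th')
  (etrans c1 (etrans (congr1 _ (esym eth')) (compA _ _ _))).
have ww' : w' \oc w = idm _.
  have [v [_ vu]] := u1 _ (canon (leUl x f)) (canon (leUr f x)) c1.
  rewrite -(vu (w' \oc w)) ?(vu (idm _)) ?comp1m //.
  by split; rewrite -compA ?w1 ?w2 ?w1' // compA w2' -compA th'th compm1.
have w'w : w \oc w' = idm _.
  have [v [_ vu]] := u2 _ (canon (leUl x f')) (canon (leUr f' x)) c2.
  rewrite -(vu (w \oc w')) ?(vu (idm _)) ?comp1m //.
  by split; rewrite -compA ?w1' ?w2' ?w1 // compA w2 -compA thth' compm1.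
have wi : is_iso w by exists w'.
have [g gi eg] := symF erefl erefl (mmorP (srepr (x `|` f)%O))
  (mmorP (srepr (x `|` f')%O)) wi.
have [g' gg' g'g] := gi; exists (MkAut gg' g'g); split.
  apply/sub_act_eqP; exists (idm _); first exact: is_iso_id.
  by rewrite compm1 /= -(canonP (leUl x f)) compA eg -compA w1 canonP canonP.
apply/sub_act_eqP; exists th => //=.
by rewrite -(canonP (leUr f x)) compA eg -compA w2 compA canonP.
Qed.

(** The class of x /\ f -> x determines the orbit of (x, f). *)
Lemma meet_orbit x f x' f' :
  stau f = phi -> stau f' = phi -> ole (stau x) phi ->
  incl_class (x `&` f)%O x = incl_class (x' `&` f')%O x' ->
  exists g, sub_act g x = x' /\ sub_act g f = f'.
Proof.
move=> tf tf' tx /(incl_class_eqP symF (leIl _ _) (leIl _ _))[g [gz gx]].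
have e : (x' `&` sub_act g f = x' `&` f')%O by rewrite -gz sub_act_meet gx.
have [||h [hx hf]] := meet_fix _ tf' _ e;
  rewrite ?sub_act_stau -?gx ?sub_act_stau //.
by exists (h * g)%g; rewrite !sub_actM gx hx hf.
Qed.

Lemma exists_above x : ole (stau x) phi -> exists2 f, stau f = phi & (x <= f)%O.
Proof.
move=> tx; have [f0 tf0] := ole_sub_top le_phi.
have [x0 le0 tx0] : exists2 y, (y <= f0)%O & stau y = stau x.
  by apply: ole_sub; rewrite tf0.
have [g gx] := stau_transitive symF tx0.
by exists (sub_act g f0); rewrite ?sub_act_stau // -gx sub_act_le.
Qed.

(** Every subobject y of x is the meet of x with some f of type phi: take f' of
    type phi containing x and f'' of type phi meeting f' in the type of y; an
    automorphism fixing f' carries the meet of f' and f'' to y. *)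
Lemma meet_surj x y : ole (stau x) phi -> (y <= x)%O ->
  exists2 f, stau f = phi & (x `&` f)%O = y.
Proof.
move=> tx le_yx; have [f' tf' le_xf'] := exists_above tx.
have ty : ole (stau y) phi by apply: ole_trans tx; apply: stau_le.
case: couple => _ _ _ /(_ F f' (stau y) erefl tf' ty)[[f'' [tf'' tm]] _].
have /(incl_class_eqP symF (leIl _ _) (le_trans le_yx le_xf'))[g [gm gf]] :
    incl_class (f' `&` f'')%O f' = incl_class y f'.
  by apply: incl_class_phi => //; [exact: leIl|exact: le_trans le_xf'].
exists (sub_act g f''); first by rewrite sub_act_stau.
have -> : x = (x `&` f')%O by apply/esym/meet_idPl.
by rewrite -meetA -{1}gf -sub_act_meet gm; apply/meet_idPr.
Qed.

(** Orbits on pairs of subobjects of type phi are symmetric; this is what makes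
    the endomorphism algebra of F_phi commutative. *)
Lemma meet_orbit_sym f f' : stau f = phi -> stau f' = phi ->
  exists g, sub_act g f = f' /\ sub_act g f' = f.
Proof.
move=> tf tf'; apply: meet_orbit; rewrite ?tf //; first exact: ole_refl.
by apply: incl_class_phi; rewrite ?leIl ?leIr // meetC.
Qed.

Lemma ole_anti (l n : otype C) : ole n phi -> ole l n -> ole n l -> l = n.
Proof.
move=> nphi; have [x <-] := ole_sub_top (ole_trans nphi le_phi).
move=> /ole_sub[y yx <-] /ole_sub[z zy zx].
by have := eq_of_stau symF (le_trans zy yx) zx; move=> ez;
  congr (stau _); apply/le_anti; rewrite yx -ez zy.
Qed.

Lemma hook_ole (l n : otype C) (m : monic_class C) : hook_pred l n m -> ole l n.
Proof.
move=> /andP[/eqP <- /eqP <-]; apply/asboolP.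
by exists (asrc (arepr m)), (atgt (arepr m)), (arepr m); split=> //;
  apply: amorP.
Qed.

Lemma hook_phi_uniq (l : otype C) (m m' : monic_class C) :
  hook_pred l phi m -> hook_pred l phi m' -> m = m'.
Proof.
have [f tf] := ole_sub_top le_phi; rewrite -tf.
move=> /(incl_class_surj (x := f))[y [yf <- ty]].
move=> /(incl_class_surj (x := f))[y' [yf' <- ty']].
by apply: incl_class_phi; rewrite ?ty.
Qed.

Lemma hook_refl_uniq (l : otype C) x (m : monic_class C) : ole l phi ->
  hook_pred l l m -> stau x = l -> m = incl_class x x.
Proof.
move=> lphi + tx; rewrite -{2}tx => /(incl_class_surj (x := x))[y [yx <- ty]].
by rewrite (eq_of_stau symF yx) // ty.
Qed.

End Couple.

(** * Linear algebra over the rationals *)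

Section Families.
Variables (V : vectType rat) (I : finType) (v : I -> V).
Implicit Types P Q : pred I.

(** The span of the members of a finite family that satisfy P. *)
Definition spanf P : {vspace V} := (\sum_(i | P i) <[v i]>)%VS.

(** Linear independence of a finite family. *)
Definition indep : Prop :=
  forall a : I -> rat, \sum_i a i *: v i = 0 -> forall i, a i = 0.

Lemma spanfP P w :
  w \in spanf P <-> exists a : I -> rat, w = \sum_(i | P i) a i *: v i.
Proof.
split=> [/memv_sumP[u uv ->]|[a ->]]; last first.
  by apply: memv_sumr => i Pi; apply/memvZ/memv_line.
have /choice[a av] i : exists a, P i -> u i = a *: v i.
  case Pi : (P i); last by exists 0.
  by have /vlineP[a ->] := uv i Pi; exists a.
by exists a; apply: eq_bigr => i /av.
Qed.

Lemma mem_spanf P i : P i -> v i \in spanf P.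
Proof. by move=> Pi; rewrite memvE; apply: (sumv_sup i). Qed.

Lemma spanfS P Q : subpred P Q -> (spanf P <= spanf Q)%VS.
Proof.
by move=> PQ; apply/subv_sumP => i /PQ; rewrite -memvE; apply: mem_spanf.
Qed.

Lemma dim_spanf P : (\dim (spanf P) <= #|I|)%N.
Proof.
apply: leq_trans (dimv_leq_sum _ _ _) _.
rewrite -sum1_card [leqRHS](bigID P) /=.
by apply: leq_trans (leq_addr _ _); apply: leq_sum => i _;
  rewrite dim_vline leq_b1.
Qed.

Hypothesis v_indep : indep.

Lemma indep_neq0 i : v i != 0.
Proof.
apply/eqP => vi0; have := v_indep (a := fun j => (j == i)%:R).
rewrite (bigD1 i) //= vi0 scaler0 big1 ?addr0 => [/(_ erefl i)/eqP|j /negPf->].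
  by rewrite eqxx oner_eq0.
by rewrite scale0r.
Qed.

Lemma indep_dim : \dim (spanf predT) = #|I|.
Proof.
have /directvP/= -> : directv (\sum_i <[v i]>).
  apply/directv_sum_independent => u uv u0 i _.
  have /choice[a av] j : exists a, u j = a *: v j by apply/vlineP; apply: uv.
  rewrite av (v_indep (a := a)) ?scale0r // -[RHS]u0.
  by apply: eq_bigr => j _; rewrite av.
by rewrite -sum1_card; apply: eq_bigr => i _; rewrite dim_vline indep_neq0.
Qed.

Lemma indep_coef P t i : ~~ P i -> t *: v i \in spanf P -> t = 0.
Proof.
move=> Pi /spanfP[a e].
have := v_indep
  (a := fun j => (if P j then a j else 0) - (if j == i then t else 0)).
move=> /(_ _ i); rewrite eqxx (negPf Pi) sub0r => H.
apply/eqP; rewrite -oppr_eq0; apply/eqP/H.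
under eq_bigr do rewrite scalerBl.
rewrite sumrB [X in _ - X](bigD1 i) //= eqxx [X in _ - (_ + X)]big1; last first.
  by move=> j /negPf->; rewrite scale0r.
rewrite addr0 e [X in _ - X]big_mkcond /= -sumrB big1 // => j _.
by case: ifP; rewrite ?scale0r subrr.
Qed.

End Families.

Section Orthogonal.
Variables (V : vectType rat) (b : V -> V -> rat).
Hypothesis b_linear : forall u, linear_for *%R (b u).
Hypothesis b_sym : forall u v, b u v = b v u.
Hypothesis b_def : forall u, b u u = 0 -> u = 0.

(** For a definite symmetric bilinear form, every subspace is complemented by
    its orthogonal. *)
Lemma orth_complement (W : {vspace V}) : exists W' : {vspace V},
  [/\ (W + W' = fullv)%VS, (W :&: W' = 0)%VS &
      forall v, v \in W' <-> forall u, u \in W -> b u v = 0].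
Proof.
pose B u : {scalar V} :=
  HB.pack (b u) (GRing.isLinear.Build _ _ _ _ _ (b_linear u)).
have bE u v : b u v = B u v by [].
pose f (v : V) : 'rV[rat]_(\dim W) := \row_i b (vbasis W)`_i v.
have f_lin : linear f.
  by move=> a u v; apply/rowP => i; rewrite !mxE b_linear.
pose fL : {linear V -> 'rV[rat]_(\dim W)} :=
  HB.pack f (GRing.isLinear.Build _ _ _ _ _ f_lin).
pose W' := lker (linfun fL).
have W'P v : v \in W' <-> forall u, u \in W -> b u v = 0.
  rewrite memv_ker lfunE /=; split=> [/eqP fv u uW|H]; last first.
    apply/eqP/rowP => i; rewrite !mxE H // vbasis_mem // mem_nth //.
    by rewrite size_tuple.
  rewrite b_sym (coord_vbasis uW) bE linear_sum big1 // => i _.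
  rewrite linearZ /= b_sym.
  by have /rowP/(_ i) := fv; rewrite !mxE => ->; rewrite mulr0.
have cap0 : (W :&: W' = 0)%VS.
  apply/eqP; rewrite -subv0; apply/subvP => u; rewrite memv_cap memv0.
  by move=> /andP[uW /W'P/(_ u uW)/b_def->].
exists W'; split=> //; apply/eqP; rewrite eqEdim subvf /=.
rewrite (dimv_disjoint_sum cap0) -(limg_ker_dim (linfun fL) fullv) capfv addnC.
rewrite leq_add2r; apply: leq_trans (dimvS (subvf _)) _.
by rewrite dimvf -[leqRHS]mul1n.
Qed.

End Orthogonal.

Section Kernels.
Variable S : finType.
Local Notation M := 'M[rat]_#|S|.
Implicit Types (A B : M) (x y z : S).

(** The entry of a matrix at a pair of elements of S, and the matrix with given
    entries. *)
Definition ent A x y : rat := A (enum_rank x) (enum_rank y).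
Definition ker_mx (k : S -> S -> rat) : M :=
  \matrix_(i, j) k (enum_val i) (enum_val j).

Lemma entK k x y : ent (ker_mx k) x y = k x y.
Proof. by rewrite /ent mxE !enum_rankK. Qed.

Lemma entP A B : (forall x y, ent A x y = ent B x y) <-> A = B.
Proof.
split=> [e|-> //]; apply/matrixP => i j.
by have := e (enum_val i) (enum_val j); rewrite /ent !enum_valK.
Qed.

Lemma ent0 x y : ent 0 x y = 0. Proof. by rewrite /ent mxE. Qed.
Lemma entZ a A x y : ent (a *: A) x y = a * ent A x y.
Proof. by rewrite /ent mxE. Qed.
Lemma ent_tr A x y : ent A^T x y = ent A y x.
Proof. by rewrite /ent mxE. Qed.
Lemma ent_sum (I : finType) (P : pred I) (A : I -> M) x y :
  ent (\sum_(i | P i) A i) x y = \sum_(i | P i) ent (A i) x y.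
Proof. by rewrite /ent summxE. Qed.
Lemma ent_mul A B x z : ent (A *m B) x z = \sum_y ent A x y * ent B y z.
Proof.
rewrite /ent mxE (reindex (@enum_rank S)) //.
by exists enum_val => i _; rewrite ?enum_rankK ?enum_valK.
Qed.

Lemma ent_mul_neq0 A B x z : ent (A *m B) x z != 0 ->
  exists2 y, ent A x y != 0 & ent B y z != 0.
Proof.
rewrite ent_mul => H; have [y] : exists y, ent A x y * ent B y z != 0.
  apply/existsP; rewrite -negb_forall; apply: contra H => /forallP H.
  by rewrite big1 // => y _; apply/eqP.
by rewrite mulf_eq0 negb_or => /andP[]; exists y.
Qed.

(** The trace form, that is, the sum of the products of the entries. *)
Definition trform A B : rat := \tr (A *m B^T).

Lemma trform_linear A : linear_for *%R (trform A).
Proof.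
by move=> a B B'; rewrite /trform linearP /= mulmxDr -scalemxAr linearP.
Qed.

Lemma trform_sym A B : trform A B = trform B A.
Proof. by rewrite /trform -mxtrace_tr trmx_mul trmxK. Qed.

Lemma trform_def A : trform A A = 0 -> A = 0.
Proof.
move=> A0; have ge0 i j : 0 <= A i j * A^T j i by rewrite mxE -expr2 sqr_ge0.
have ge0s i : 0 <= (A *m A^T) i i by rewrite mxE; apply: sumr_ge0 => j _.
apply/matrixP => i j; rewrite [RHS]mxE.
move/eqP: A0; rewrite /trform /mxtrace psumr_eq0 // => /allP/(_ i).
rewrite mem_index_enum => /(_ isT); rewrite mxE psumr_eq0 // => /allP/(_ j).
by rewrite mem_index_enum => /(_ isT); rewrite mxE -expr2 sqrf_eq0 => /eqP.
Qed.

(** A matrix whose entry at (x, y) depends only on a class [cl x y], and which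
    is supported on [dom], is a combination of the indicators of the
    classes. *)
Lemma class_expansion (T : eqType) (J : finType) (v : J -> T)
    (dom : rel S) (cl : S -> S -> T) A :
  injective v ->
  (forall x y, ent A x y != 0 -> dom x y /\ exists i, cl x y = v i) ->
  (forall x y x' y', dom x y -> dom x' y' -> cl x y = cl x' y' ->
     ent A x y = ent A x' y') ->
  exists a : J -> rat,
    A = \sum_i a i *: ker_mx (fun x y => (dom x y && (cl x y == v i))%:R).
Proof.
move=> v_inj suppA clA.
pose a i := if [pick p : S * S | dom p.1 p.2 && (cl p.1 p.2 == v i)] is Some p
            then ent A p.1 p.2 else 0.
exists a; apply/entP => x y; rewrite ent_sum.
under eq_bigr do rewrite entZ entK.
have [Axy|/suppA[dxy [i ei]]] := eqVneq (ent A x y) 0.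
  rewrite big1 // => i _; case: andP => [[dxy /eqP ei]|]; last by rewrite mulr0.
  rewrite mulr1 /a; case: pickP => [p /andP[dp /eqP ep]|/(_ (x, y))] /=;
      last first.
    by rewrite dxy ei eqxx.
  by rewrite -(clA x y) // ei ep.
rewrite (bigD1 i) //= dxy ei eqxx mulr1 big1 ?addr0 => [|j ji]; last first.
  by rewrite (inj_eq v_inj) eq_sym (negPf ji) mulr0.
rewrite /a; case: pickP => [p /andP[dp /eqP ep]|/(_ (x, y))] /=; last first.
  by rewrite dxy ei eqxx.
by apply: clA => //; rewrite ei ep.
Qed.

End Kernels.

(** * Invariant kernels *)

(** Matrices indexed by all subobjects of F.  A kernel between functions on
    subobjects of two given types is such a matrix supported on the pairs of
    these types; this makes all kernels composable. *)
Local Notation kmx F := 'M[rat]_#|(subobj F : finType)|.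

Section InvariantKernels.
Variables (C : flcategory) (F : C).
Implicit Types (g : aut F) (x y f : subobj F) (A B : kmx F) (l n : otype C).

(** Invariance under the automorphisms of F. *)
Definition kinvariant A : Prop :=
  forall g x y, ent A (sub_act g x) (sub_act g y) = ent A x y.

(** Nonzero entries only at pairs of subobjects of types l and n. *)
Definition ksupport l n A : Prop :=
  forall x y, ent A x y != 0 -> stau x = l /\ stau y = n.

Lemma kinvariant_tr A : kinvariant A -> kinvariant A^T.
Proof. by move=> iA g x y; rewrite !ent_tr. Qed.

Lemma kinvariant_mul A B : kinvariant A -> kinvariant B -> kinvariant (A *m B).
Proof.
move=> iA iB g x z; rewrite !ent_mul (reindex_inj (@sub_act_inj _ _ g)) /=.
by apply: eq_bigr => y _; rewrite iA iB.
Qed.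

Lemma kinvariant_sum (I : finType) (P : pred I) (a : I -> rat)
    (A : I -> kmx F) :
  (forall i, P i -> kinvariant (A i)) -> kinvariant (\sum_(i | P i) a i *: A i).
Proof.
move=> iA g x y; rewrite !ent_sum; apply: eq_bigr => i Pi.
by rewrite !entZ iA.
Qed.

Lemma kinvariantZ a A : kinvariant A -> kinvariant (a *: A).
Proof. by move=> iA g x y; rewrite !entZ iA. Qed.

Lemma ksupport_tr l n A : ksupport l n A -> ksupport n l A^T.
Proof. by move=> sA x y; rewrite ent_tr => /sA[]. Qed.

Lemma ksupport_mul l n A B : (forall x y, ent A x y != 0 -> stau x = l) ->
  (forall x y, ent B x y != 0 -> stau y = n) -> ksupport l n (A *m B).
Proof. by move=> sA sB x z /ent_mul_neq0[y /sA ? /sB]. Qed.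

Lemma ksupport_mulmx l n k h A B : ksupport l k A -> ksupport h n B ->
  ksupport l n (A *m B).
Proof.
by move=> sA sB; apply: ksupport_mul => [x y /sA[]|x y /sB[]].
Qed.

Lemma ksupport_sum l n (I : finType) (P : pred I) (a : I -> rat)
    (A : I -> kmx F) :
  (forall i, P i -> ksupport l n (A i)) ->
  ksupport l n (\sum_(i | P i) a i *: A i).
Proof.
move=> sA x y; rewrite ent_sum => H.
have [i /andP[Pi]] : exists i, P i && (ent (A i) x y != 0).
  apply/existsP; rewrite -negb_forall_in; apply: contra H => /forall_inP H.
  by rewrite big1 // => i Pi; rewrite entZ (eqP (H i Pi)) mulr0.
exact: sA.
Qed.

Lemma ksupportZ l n a A : ksupport l n A -> ksupport l n (a *: A).
Proof. by move=> sA x y; rewrite entZ mulf_eq0 negb_or => /andP[_ /sA]. Qed.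

(** The indicator of the pairs (x, y) with y <= x whose inclusion y -> x has
    class m. *)
Definition incl_mx (m : monic_class C) : kmx F :=
  ker_mx (fun x y : subobj F => ((y <= x)%O && (incl_class y x == m))%:R).

Lemma incl_mx_neq0 m x y : ent (incl_mx m) x y != 0 ->
  (y <= x)%O /\ incl_class y x = m.
Proof. by rewrite entK; case: andP => [[? /eqP]|]; rewrite ?eqxx. Qed.

Lemma incl_mx_supp l n m : hook_pred l n m -> ksupport n l (incl_mx m).
Proof.
move=> lnm x y /incl_mx_neq0[/incl_class_hook + e]; rewrite e.
by move=> /hook_pred_uniq/(_ lnm)[].
Qed.

Variable phi : otype C.
Hypothesis couple : symmetric_couple (tau F) phi.

Let symF : symmetric_type (tau F). Proof. by case: couple. Qed.
Let le_phi : ole phi (tau F). Proof. by case: couple. Qed.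

Lemma incl_mx_inv m : kinvariant (incl_mx m).
Proof.
move=> g x y; rewrite !entK sub_act_le; case: (boolP (y <= x)%O) => //= le.
by rewrite (incl_class_act symF).
Qed.

(** Invariant kernels supported on inclusions are combinations of the
    [incl_mx m]. *)
Lemma incl_mx_expansion l n A : kinvariant A -> ksupport n l A ->
  (forall x y, ent A x y != 0 -> (y <= x)%O) ->
  exists a : hooks l n -> rat, A = \sum_m a m *: incl_mx (val m).
Proof.
move=> iA sA leA.
apply: (class_expansion (dom := fun x y : subobj F => (y <= x)%O)
  (cl := fun x y => incl_class y x) (v := fun m : hooks l n => val m)).
- exact: val_inj.
- move=> x y Axy; have le := leA _ _ Axy; have [tx ty] := sA _ _ Axy.
  have h : hook_pred l n (incl_class y x) by rewrite -tx -ty incl_class_hook.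
  by split=> //; exists (Sub (incl_class y x) h : hooks l n).
move=> x y x' y' le le' /(incl_class_eqP symF le le')[g [<- <-]].
by rewrite iA.
Qed.

Lemma incl_mx_mul l k n (i : hooks l n) (j : hooks k l) :
  exists a : hooks k n -> rat,
    incl_mx (val i) *m incl_mx (val j) = \sum_m a m *: incl_mx (val m).
Proof.
apply: incl_mx_expansion.
- exact: kinvariant_mul (incl_mx_inv _) (incl_mx_inv _).
- exact: ksupport_mulmx (incl_mx_supp (valP i)) (incl_mx_supp (valP j)).
by move=> x y /ent_mul_neq0[z /incl_mx_neq0[zx _] /incl_mx_neq0[yz _]];
  apply: le_trans zx.
Qed.

(** The kernel T_l of the map from F_phi to F_l: the indicator of the pairs
    (y, f) with y <= f, where y has type l and f has type phi. *)
Definition down_mx l : kmx F :=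
  ker_mx (fun y f : subobj F =>
    [&& (y <= f)%O, stau y == l & stau f == phi]%:R).

Lemma down_mx_neq0 l y f : ent (down_mx l) y f != 0 ->
  [/\ (y <= f)%O, stau y = l & stau f = phi].
Proof. by rewrite entK; case: and3P => [[? /eqP ? /eqP ?]|]; rewrite ?eqxx. Qed.

Lemma down_mx_inv l : kinvariant (down_mx l).
Proof. by move=> g x y; rewrite !entK sub_act_le !sub_act_stau. Qed.

Lemma down_mx_supp l : ksupport l phi (down_mx l).
Proof. by move=> x y /down_mx_neq0[]. Qed.

(** All inclusions from type l to type phi have the same class. *)
Lemma incl_mx_phi l (m : hooks l phi) : incl_mx (val m) = (down_mx l)^T.
Proof.
apply/entP => f y; rewrite ent_tr !entK; case: (boolP (y <= f)%O) => //= le.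
congr ((_ : bool)%:R); apply/eqP/andP => [e|[/eqP ty /eqP tf]]; last first.
  by apply: (hook_phi_uniq couple) (valP m); rewrite -ty -tf incl_class_hook.
by have := incl_class_hook le; rewrite e => /hook_pred_uniq/(_ (valP m))[-> ->].
Qed.

(** For y of type l and f of type phi, the number of x of type n such that
    y <= x <= f and y -> x has class m depends only on whether y <= f. *)
Lemma down_incl l n (m : hooks l n) :
  exists t, (down_mx n)^T *m incl_mx (val m) = t *: (down_mx l)^T.
Proof.
have [||x y|a ->] :=
  @incl_mx_expansion l phi ((down_mx n)^T *m incl_mx (val m)).
- exact: kinvariant_mul (kinvariant_tr (@down_mx_inv _)) (incl_mx_inv _).
- exact: ksupport_mulmx (ksupport_tr (@down_mx_supp _)) (incl_mx_supp (valP m)).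
- move=> /ent_mul_neq0[z]; rewrite ent_tr.
  by move=> /down_mx_neq0[zx _ _] /incl_mx_neq0[yz _]; apply: le_trans zx.
exists (\sum_m a m); rewrite scaler_suml; apply: eq_bigr => i _.
by rewrite incl_mx_phi.
Qed.

Local Notation L := (types_le phi).

(** The classes of monics into an object of type n from an object whose type,
    the tag, is at most phi. *)
Definition hooks_to n : finType := {l : L & hooks (val l) n}.

(** The class itself, without its source and target types. *)
Definition hook_class n (m : hooks_to n) : monic_class C := val (tagged m).

Lemma hook_classP n (m : hooks_to n) : hook_pred (val (tag m)) n (hook_class m).
Proof. exact: valP. Qed.

Lemma hook_class_inj n : injective (@hook_class n).
Proof.
move=> [l1 h1] [l2 h2]; rewrite /hook_class /= => e.
have [/val_inj el _] :=
  hook_pred_uniq (valP h1) (etrans (congr1 _ e) (valP h2)).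
by subst l2; rewrite (val_inj e).
Qed.

Definition le_type : rel L := fun l n : L => ole (val l) (val n).

(** Strictly increasing in l; used for induction on types. *)
Definition type_rank (l : L) : nat := #|[pred k : L | le_type k l]|.

Lemma le_type_refl : reflexive le_type.
Proof.
by move=> l; apply: ole_refl.
Qed.
Lemma le_type_trans : transitive le_type.
Proof.
by move=> l m n; apply: ole_trans.
Qed.
Lemma le_type_anti (l n : L) : le_type l n -> le_type n l -> l = n.
Proof. by move=> ln nl; apply/val_inj/(ole_anti couple (valP n)). Qed.

Lemma type_rank_lt (l n : L) : le_type l n -> l != n ->
  (type_rank l < type_rank n)%N.
Proof.
move=> ln l'n; apply/proper_card/properP; split.
  by apply/subsetP=> k; rewrite !inE => /le_type_trans; apply.
exists n; rewrite inE ?le_type_refl //; apply: contra l'n => nl.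
exact/eqP/le_type_anti.
Qed.

(** The entry at (x, f), for f of type phi, is the number of y <= x /\ f such
    that y -> x has class m. *)
Definition meet_mx n (m : hooks_to n) : kmx F :=
  incl_mx (hook_class m) *m down_mx (val (tag m)).

Lemma meet_mx_inv n (m : hooks_to n) : kinvariant (meet_mx m).
Proof. exact: kinvariant_mul (incl_mx_inv _) (@down_mx_inv _). Qed.

Lemma meet_mx_supp n (m : hooks_to n) : ksupport n phi (meet_mx m).
Proof.
exact: ksupport_mulmx (incl_mx_supp (hook_classP m)) (@down_mx_supp _). 
Qed.

Lemma meet_mx_neq0 n (m : hooks_to n) x f : ent (meet_mx m) x f != 0 ->
  exists y, [/\ (y <= x `&` f)%O, incl_class y x = hook_class m &
                stau y = val (tag m)].
Proof.
move=> /ent_mul_neq0[y /incl_mx_neq0[yx e] /down_mx_neq0[yf ty _]].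
by exists y; rewrite lexI yx yf.
Qed.

Lemma meet_mx_diag n (m : hooks_to n) x f : stau f = phi ->
  incl_class (x `&` f)%O x = hook_class m -> ent (meet_mx m) x f = 1.
Proof.
move=> tf e; have tz : stau (x `&` f)%O = val (tag m).
  by have := incl_class_hook (leIl x f);
    rewrite e => /hook_pred_uniq/(_ (hook_classP m))[].
rewrite ent_mul (bigD1 (x `&` f)%O) //= !entK leIl leIr e tz tf !eqxx mulr1.
rewrite big1 ?addr0 // => y yz; apply/eqP; rewrite mulf_eq0.
apply: contraR yz; rewrite negb_or.
move=> /andP[/incl_mx_neq0[yx _] /down_mx_neq0[yf ty _]].
by apply/eqP/(eq_of_stau symF); rewrite ?lexI ?yx // ty.
Qed.

(** With [meet_mx_diag]: the matrices [meet_mx m] are unitriangular with respect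
    to the indicators of the orbits, for the order on sources. *)
Lemma meet_mx_triangular n (m m' : hooks_to n) x f :
  incl_class (x `&` f)%O x = hook_class m' ->
  ent (meet_mx m) x f != 0 -> m != m' ->
  le_type (tag m) (tag m') /\ tag m != tag m'.
Proof.
move=> e /meet_mx_neq0[y [yz ey ty]] mm'.
have tz : stau (x `&` f)%O = val (tag m').
  by have := incl_class_hook (leIl x f);
    rewrite e => /hook_pred_uniq/(_ (hook_classP m'))[].
split; first by rewrite /le_type -ty -tz stau_le.
apply: contra mm' => /eqP et; apply/eqP/hook_class_inj; rewrite -e -ey.
by rewrite (eq_of_stau symF yz) // ty et.
Qed.

Lemma meet_mx_indep n : ole n phi -> indep (@meet_mx n).
Proof.
move=> nphi; have [x tx] := ole_sub_top (ole_trans nphi le_phi); subst n.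
move=> a a0 m; apply/eqP/negPn/negP => am.
(* Evaluate a relation on the orbit of a class of minimal source among those
   with a nonzero coefficient. *)
have [m0 am0 m0_min] :=
  @arg_minnP (hooks_to (stau x)) m (fun m => a m != 0)
    (fun m => type_rank (tag m)) am.
have [y [yx ey ty]] := incl_class_surj (hook_classP m0).
have [f tf ef] := meet_surj couple nphi yx.
rewrite -ef in ey.
have /entP/(_ x f) := a0; rewrite ent_sum ent0 (bigD1 m0) //= entZ.
rewrite meet_mx_diag // mulr1 big1 ?addr0 => [/eqP|m' m'm0]; first exact/negP.
apply/eqP; rewrite entZ mulf_eq0; apply: contraT.
rewrite negb_or => /andP[am' H].
have [le ne] := meet_mx_triangular ey H m'm0.
by have := m0_min _ am'; rewrite leqNgt type_rank_lt.
Qed.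

(** The intertwiners from F_phi to F_n are spanned by the [meet_mx m]: they are
    spanned by the indicators D of the orbits, which are no more numerous than
    the independent [meet_mx m]. *)
Lemma meet_mx_span n A : ole n phi -> kinvariant A -> ksupport n phi A ->
  A \in spanf (@meet_mx n) predT.
Proof.
move=> nphi.
pose D (m : hooks_to n) : kmx F := ker_mx (fun x f : subobj F =>
  ((stau f == phi) && (incl_class (x `&` f)%O x == hook_class m))%:R).
have AD B : kinvariant B -> ksupport n phi B -> B \in spanf D predT.
  move=> iB sB; apply/spanfP.
  have := class_expansion
    (dom := fun x f : subobj F => (stau x == n) && (stau f == phi))
    (cl := fun x f => incl_class (x `&` f)%O x) (v := @hook_class n) (A := B).
  case=> [|x f|x f x' f'|a ->].
  - exact: hook_class_inj.
  - move=> /sB[tx tf]; rewrite tx tf !eqxx; split=> //.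
    have h := incl_class_hook (leIl x f); rewrite tx in h.
    have tz : ole (stau (x `&` f)%O) phi.
      by apply: ole_trans nphi; exact: hook_ole h.
    pose l : L := exist _ (stau (x `&` f)%O) tz.
    by exists (Tagged (fun l : L => hooks (val l) n)
                 (exist _ (incl_class (x `&` f)%O x) h : hooks (val l) n)).
  - move=> /andP[/eqP tx /eqP tf] /andP[_ /eqP tf'] e.
    have [|g [<- <-]] := meet_orbit couple tf tf' _ e; first by rewrite tx.
    by rewrite iB.
  exists a; apply: eq_bigr => m _; congr (_ *: _); apply/entP => x f.
  rewrite !entK; case: (eqVneq (incl_class _ _) _) => [e|_];
    rewrite ?andbF // !andbT.
  have := incl_class_hook (leIl x f); rewrite e.
  by move=> /hook_pred_uniq/(_ (hook_classP m))[_ ->]; rewrite eqxx.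
suff <- : spanf D predT = spanf (@meet_mx n) predT by exact: AD.
apply/esym/eqP; rewrite eqEdim (indep_dim (meet_mx_indep nphi)) dim_spanf andbT.
by apply/subv_sumP => m _; rewrite -memvE; apply: AD;
  [exact: meet_mx_inv|exact: meet_mx_supp].
Qed.

(** The only class from l to l is that of the isomorphisms. *)
Lemma meet_mx_top (l : L) (m : hooks_to (val l)) : tag m = l ->
  meet_mx m = down_mx (val l).
Proof.
move=> tm; have hm : hook_pred (val l) (val l) (hook_class m).
  by rewrite -{1}tm hook_classP.
rewrite /meet_mx tm; apply/entP => x f; rewrite ent_mul.
have [tx|tx] := eqVneq (stau x) (val l).
  have e := hook_refl_uniq couple (valP l) hm tx.
  rewrite (bigD1 x) //= entK lexx e eqxx mul1r big1 ?addr0 // => y yx.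
  apply/eqP; rewrite mulf_eq0; apply: contraR yx; rewrite negb_or.
  move=> /andP[/incl_mx_neq0[yx _] /down_mx_neq0[_ ty _]].
  by apply/eqP/(eq_of_stau symF yx); rewrite ty.
rewrite big1 => [|y _]; last first.
  apply/eqP; rewrite mulf_eq0; apply: contraR tx; rewrite negb_or.
  by move=> /andP[/(incl_mx_supp hm)[->]].
by apply/esym/eqP; apply: contraR tx => /down_mx_neq0[_ -> _].
Qed.

End InvariantKernels.

(** * The endomorphism algebra of F_phi *)

Section EndAlgebra.
Variables (C : flcategory) (F : C) (phi : otype C).
Hypothesis couple : symmetric_couple (tau F) phi.
Local Notation L := (types_le phi).
Local Notation down l := (down_mx F phi (val l)).
Local Notation meetm n := (@meet_mx C F phi n).
Implicit Types (g : aut F) (x y f : subobj F) (A q u : kmx F) (k l : L).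
Implicit Types n : otype C.

Let le_phi : ole phi (tau F). Proof. by case: couple. Qed.

(** The kernel c_l = T_l^T T_l; its entry at (f, f') is the number of
    subobjects of type l of f /\ f'. *)
Definition common_mx l : kmx F := (down l)^T *m down l.

Lemma common_mx_inv l : kinvariant (common_mx l).
Proof.
exact: kinvariant_mul (kinvariant_tr (@down_mx_inv _ _ _ _)) (@down_mx_inv _ _
  _ _).
Qed.

Lemma common_mx_supp l : ksupport phi phi (common_mx l).
Proof.
exact: ksupport_mulmx (ksupport_tr (@down_mx_supp _ _ _ _)) (@down_mx_supp _ _
  _ _).
Qed.

Lemma spanf_common_inv P A : A \in spanf common_mx P -> kinvariant A.
Proof.
by move=> /spanfP[a ->]; apply: kinvariant_sum => l _; apply: common_mx_inv.
Qed.

Lemma spanf_common_supp P A : A \in spanf common_mx P -> ksupport phi phi A.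
Proof.
by move=> /spanfP[a ->]; apply: ksupport_sum => l _; apply: common_mx_supp.
Qed.

(** The basis [meet_mx m] for n = phi consists of the c_l. *)
Lemma meet_mx_phi (m : hooks_to phi phi) : meetm phi m = common_mx (tag m).
Proof. by rewrite /meet_mx /common_mx (incl_mx_phi couple). Qed.

(** There is exactly one class from each l to phi; see [tag_phi_inj]. *)
Lemma top_hook l : exists m : hooks_to phi phi, tag m = l.
Proof.
have [f tf] := ole_sub_top le_phi.
have [y yf ty] : exists2 y : subobj F, (y <= f)%O & stau y = val l.
  by apply: ole_sub; rewrite tf (valP l).
have h := incl_class_hook yf; rewrite tf ty in h.
by exists (Tagged (fun l : L => hooks (val l) phi)
             (exist _ (incl_class y f) h : hooks (val l) phi)).
Qed.

Lemma tag_phi_inj : injective (fun m : hooks_to phi phi => tag m).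
Proof.
move=> m m' e; apply/hook_class_inj/(hook_phi_uniq couple (hook_classP m)).
by rewrite e; apply: hook_classP.
Qed.

Lemma common_mx_indep : indep common_mx.
Proof.
move=> a a0 l; have [m <-] := top_hook l.
apply: (meet_mx_indep couple (@ole_refl _ _) (a := fun m => a (tag m))).
have /choice[t tK] := top_hook.
rewrite -[RHS]a0 [RHS](reindex (fun m : hooks_to phi phi => tag m)) /=.
  by apply: eq_bigr => m' _; rewrite meet_mx_phi.
by exists t => // m' _; apply: tag_phi_inj; rewrite tK.
Qed.

Lemma common_mx_span A : kinvariant A -> ksupport phi phi A ->
  A \in spanf common_mx predT.
Proof.
move=> iA sA; have := meet_mx_span couple (@ole_refl _ _) iA sA.
apply/subvP/subv_sumP => m _; rewrite -memvE meet_mx_phi; exact: mem_spanf.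
Qed.

(** Expanding T_k A on the [meet_mx m] with m into k, and using [down_incl],
    shows that c_k A only involves the c_l with l <= k. *)
Lemma common_mx_ideal k A : kinvariant A -> ksupport phi phi A ->
  common_mx k *m A \in spanf common_mx (fun l => le_type l k).
Proof.
move=> iA sA; rewrite -mulmxA.
have : down k *m A \in spanf (meetm (val k)) predT.
  apply: (meet_mx_span couple (valP k));
    first exact: kinvariant_mul (@down_mx_inv _ _ _ _) iA.
  exact: ksupport_mulmx (@down_mx_supp _ _ _ _) sA.
move=> /spanfP[a ->]; rewrite mulmx_sumr; apply: memv_suml => m _.
rewrite -scalemxAr memvZ // /meet_mx mulmxA.
have [t ->] := down_incl couple (tagged m).
rewrite -scalemxAl memvZ //; apply: mem_spanf.
exact: hook_ole (hook_classP m).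
Qed.

(** Downward closed sets of types. *)
Definition dclosed (P : pred L) := forall k l, le_type k l -> P l -> P k.

Lemma spanf_ideal P A X : dclosed P -> A \in spanf common_mx P ->
  kinvariant X -> ksupport phi phi X -> A *m X \in spanf common_mx P.
Proof.
move=> dP /spanfP[a ->] iX sX; rewrite mulmx_suml; apply: memv_suml => l Pl.
rewrite -scalemxAl memvZ //; have := common_mx_ideal l iX sX.
by apply/subvP/spanfS => k kl; apply: dP kl Pl.
Qed.

Lemma kernel_sym A : kinvariant A -> ksupport phi phi A -> A^T = A.
Proof.
move=> iA sA; apply/entP => x y; rewrite ent_tr.
have sym0 z w : ent A z w != 0 -> ent A w z = ent A z w.
  move=> /sA[tz tw]; have [g [gz gw]] := meet_orbit_sym couple tz tw.
  by rewrite -(iA g z w) gz gw.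
have [e|/sym0->//] := eqVneq (ent A y x) 0.
have [e'|/sym0->//] := eqVneq (ent A x y) 0.
by rewrite e e'.
Qed.

Lemma kernel_comm A X : kinvariant A -> ksupport phi phi A -> kinvariant X ->
  ksupport phi phi X -> A *m X = X *m A.
Proof.
move=> iA sA iX sX; rewrite -[LHS]kernel_sym ?trmx_mul ?kernel_sym //.
  exact: kinvariant_mul.
exact: ksupport_mulmx sA sX.
Qed.

Lemma trform_mul A X Y : kinvariant A -> ksupport phi phi A -> kinvariant X ->
  ksupport phi phi X -> kinvariant Y -> ksupport phi phi Y ->
  trform X (A *m Y) = trform (A *m X) Y.
Proof.
move=> iA sA iX sX iY sY; rewrite /trform trmx_mul !(kernel_sym iY) //
  (kernel_sym iA) //.
by rewrite mulmxA mxtrace_mulC mulmxA.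
Qed.

(** k is strictly below l. *)
Definition lt_type l k := le_type k l && (k != l).

Lemma lt_type_dclosed l : dclosed (lt_type l).
Proof.
move=> k h kh /andP[hl h'l]; rewrite /lt_type (le_type_trans kh hl) /=.
apply: contra h'l => /eqP ekl; rewrite -ekl in hl *.
by rewrite (le_type_anti couple hl kh).
Qed.

Lemma le_type_dclosed l : dclosed (fun k => le_type k l).
Proof. by move=> k h; apply: le_type_trans. Qed.

(** q is c_l corrected by lower terms so as to be orthogonal to all of them for
    the trace form. *)
Definition gram_schmidt l q : Prop :=
  q - common_mx l \in spanf common_mx (lt_type l) /\
  forall u, u \in spanf common_mx (lt_type l) -> trform u q = 0.

Lemma gram_exists l : exists q, gram_schmidt l q.
Proof.
have [W' [sumW capW W'P]] := orth_complement (@trform_linear _) (@trform_sym _)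
  (@trform_def _) (spanf common_mx (lt_type l)).
have : common_mx l \in (spanf common_mx (lt_type l) + W')%VS.
  by rewrite sumW memvf.
move=> /memv_addP[w wW [q /W'P qW e]]; exists q; split=> //.
by rewrite e opprD addrCA subrr addr0 memvN.
Qed.

Section Gram.
Variables (l : L) (q : kmx F).
Hypothesis gram_q : gram_schmidt l q.

Let qW : q - common_mx l \in spanf common_mx (lt_type l).
Proof. by case: gram_q. Qed.

Let q_orth u : u \in spanf common_mx (lt_type l) -> trform u q = 0.
Proof. by case: gram_q => _; apply. Qed.

Lemma gram_mem : q \in spanf common_mx (fun k => le_type k l).
Proof.
rewrite -(subrK (common_mx l) q) memvD ?mem_spanf ?le_type_refl //.
by apply: (subvP (spanfS _ _)) qW => k /andP[].
Qed.

Lemma gram_inv : kinvariant q.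
Proof. exact: spanf_common_inv gram_mem. Qed.

Lemma gram_supp : ksupport phi phi q.
Proof. exact: spanf_common_supp gram_mem. Qed.
Hint Resolve gram_inv gram_supp : core.

(** q involves c_l, so it has no nonzero multiple among the combinations that
    avoid c_l. *)
Lemma gram_coef P t : ~~ P l -> t *: q \in spanf common_mx P -> t = 0.
Proof.
move=> Pl tq.
apply: (indep_coef common_mx_indep (P := fun k => P k || lt_type l k) (i := l)).
  by rewrite negb_or Pl /lt_type eqxx andbF.
have -> : t *: common_mx l = t *: q - t *: (q - common_mx l).
  by rewrite scalerBr opprB addrCA subrr addr0.
apply: memvB.
  by apply: (subvP (spanfS _ _)) tq => k /= ->.
apply: memvZ; apply: (subvP (spanfS _ _)) qW => k /=.
by rewrite orbC => ->.
Qed.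

Lemma gram_neq0 : q != 0.
Proof.
apply/eqP => q0; have := @gram_coef pred0 1 isT.
by rewrite q0 scaler0 mem0v => /(_ isT)/eqP; rewrite oner_eq0.
Qed.

Lemma trform_gram : trform q q != 0.
Proof. by apply: contra gram_neq0 => /eqP/trform_def->. Qed.

(** q is an eigenvector of every A: the part of A q that is not a multiple of q
    lies in the ideal of lower terms, and is orthogonal to it because A is
    self-adjoint for the trace form. *)
Lemma gram_scal A : kinvariant A -> ksupport phi phi A ->
  exists t, A *m q = t *: q.
Proof.
move=> iA sA; have : A *m q \in spanf common_mx (fun k => le_type k l).
  by rewrite (kernel_comm iA sA) //; apply: spanf_ideal gram_mem iA sA;
    apply: le_type_dclosed.
move=> /spanfP[a e]; exists (a l); apply/eqP; rewrite -subr_eq0.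
set w := A *m q - _.
have wW : w \in spanf common_mx (lt_type l).
  have -> : w = \sum_(k | lt_type l k) a k *: common_mx k -
                a l *: (q - common_mx l).
    rewrite /w e (bigD1 l) ?le_type_refl //= scalerBr opprB.
    by rewrite addrA; congr (_ - _); rewrite addrC.
  by rewrite memvB ?memvZ //; apply/spanfP; exists a.
have iw := spanf_common_inv wW; have sw := spanf_common_supp wW.
apply/eqP/trform_def; rewrite {2}/w -trform_sym.
have tl := trform_linear w; rewrite trform_sym.
have -> : A *m q - a l *: q = (- a l) *: q + A *m q by rewrite scaleNr addrC.
rewrite tl q_orth // mulr0 add0r (trform_mul iA sA) // q_orth //.
rewrite (kernel_comm iA sA) //; apply: spanf_ideal wW iA sA;
  exact: lt_type_dclosed.
Qed.

Lemma gram_sq : exists2 t, t != 0 & q *m q = t *: q.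
Proof.
have [t e] := gram_scal gram_inv gram_supp; exists t => //.
apply: contra trform_gram => /eqP t0.
by rewrite /trform kernel_sym // e t0 scale0r mxtrace0.
Qed.

Lemma gram_common : exists2 t, t != 0 & common_mx l *m q = t *: q.
Proof.
have [t e] := gram_scal (@common_mx_inv l) (@common_mx_supp l); exists t => //.
apply: contra trform_gram => /eqP t0.
have -> : trform q q = trform (common_mx l) q.
  have lin := trform_linear q; rewrite [RHS]trform_sym.
  rewrite -{2}(subrK (common_mx l) q) -[X in X + _]scale1r lin.
  by rewrite trform_sym q_orth // mulr0 add0r.
by rewrite /trform kernel_sym // e t0 scale0r mxtrace0.
Qed.

(** T_l q is a nonzero multiple of T_l up to terms of lower source. *)
Lemma gram_down : exists2 b, b != 0 &
  down l *m q - b *: down l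
    \in spanf (meetm (val l)) (fun m => lt_type l (tag m)).
Proof.
have [b b0 e] := gram_common; exists b => //.
have : down l *m q \in spanf (meetm (val l)) predT.
  apply: (meet_mx_span couple (valP l));
    first exact: kinvariant_mul (@down_mx_inv _ _ _ _) gram_inv.
  exact: ksupport_mulmx (@down_mx_supp _ _ _ _) gram_supp.
move=> /spanfP[a ea].
pose P (m : hooks_to phi (val l)) := lt_type l (tag m).
pose s := \sum_(m | tag m == l) a m.
have es : down l *m q = s *: down l + \sum_(m | P m) a m *: meetm (val l) m.
  rewrite ea (bigID (fun m => tag m == l)) /= scaler_suml; congr (_ + _).
    by apply: eq_bigr => m /eqP tm; rewrite (meet_mx_top couple tm).
  apply: eq_bigl => m; rewrite /P /lt_type andbC; case: eqP => //= _.
  by rewrite /le_type (hook_ole (hook_classP m)).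
(* Multiplied by T_l^T, the expansion [es] expresses c_l q = b q, which fixes
   the coefficient of T_l. *)
suff -> : b = s.
  by rewrite es addrAC subrr add0r; apply/spanfP; exists a.
apply/eqP; rewrite -subr_eq0; apply/eqP.
apply: (gram_coef (P := lt_type l)); first by rewrite /lt_type eqxx andbF.
have -> : (b - s) *: q = (down l)^T *m (\sum_(m | P m) a m *: meetm (val l) m)
    - s *: (q - common_mx l).
  rewrite scalerBl -e /common_mx -mulmxA es mulmxDr -scalemxAr scalerBr opprB.
  by rewrite addrA; congr (_ - _); rewrite addrC.
apply: memvB; last exact: memvZ.
rewrite mulmx_sumr; apply: memv_suml => m Pm.
rewrite -scalemxAr memvZ // /meet_mx mulmxA.
have [t ->] := down_incl couple (tagged m).
by rewrite -scalemxAl memvZ //; apply: mem_spanf.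
Qed.

End Gram.

(** The product is a multiple of q and of u.  If l is not below k, it is a
    multiple of u in the ideal spanned by the c_h with h <= k, which contains no
    nonzero multiple of u. *)
Lemma gram_orth k l q u : gram_schmidt k q -> gram_schmidt l u -> k != l ->
  q *m u = 0.
Proof.
move=> gq gu kl.
have iq := gram_inv gq; have sq := gram_supp gq.
have iu := gram_inv gu; have su := gram_supp gu.
(* If l <= k then k is not below l, and the two factors may be exchanged. *)
wlog lk : k l q u gq gu kl iq sq iu su / ~~ le_type l k.
  move=> H; case: (boolP (le_type l k)) => [lk|]; last exact: H.
  rewrite kernel_comm //; apply: (H l k) => //; first by rewrite eq_sym.
  by apply: contra kl => kl; apply/eqP/(le_type_anti couple).
have [t e] := gram_scal gu iq sq.
rewrite e (gram_coef gu (P := fun h => le_type h k) (t := t)) ?scale0r //.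
by rewrite -e; apply: spanf_ideal (gram_mem gq) iu su; apply: le_type_dclosed.
Qed.

(** The unit of the endomorphism algebra of F_phi. *)
Definition id_mx : kmx F :=
  ker_mx (fun x y : subobj F => ((x == y) && (stau x == phi))%:R).

Lemma id_mx_inv : kinvariant id_mx.
Proof.
by move=> g x y; rewrite !entK (inj_eq (@sub_act_inj _ _ g)) sub_act_stau.
Qed.

Lemma id_mx_supp : ksupport phi phi id_mx.
Proof.
by move=> x y; rewrite entK; case: andP => [[/eqP<- /eqP ->]|]; rewrite ?eqxx.
Qed.

Lemma id_mx_mul A : ksupport phi phi A -> id_mx *m A = A.
Proof.
move=> sA; apply/entP => x y; rewrite ent_mul (bigD1 x) //= entK eqxx /=.
rewrite big1 ?addr0 => [|z zx]; last by rewrite entK eq_sym (negPf zx) mul0r.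
have [->|/sA[-> _]] := eqVneq (ent A x y) 0; first by rewrite mulr0.
by rewrite eqxx mul1r.
Qed.

Lemma meet_mx_gram n (m : hooks_to phi n) q : gram_schmidt (tag m) q ->
  exists2 b, b != 0 &
    meetm n m *m q - b *: meetm n m
      \in spanf (meetm n) (fun m' => lt_type (tag m) (tag m')).
Proof.
move=> gq; have [b b0 dm] := gram_down gq; exists b => //.
have -> : meetm n m *m q - b *: meetm n m =
    incl_mx F (hook_class m) *m (down (tag m) *m q - b *: down (tag m)).
  by rewrite mulmxBr mulmxA -scalemxAr.
move: dm => /spanfP[a ->]; rewrite mulmx_sumr; apply: memv_suml => m' lm'.
rewrite -scalemxAr memvZ // /meet_mx mulmxA.
have [c ->] := incl_mx_mul couple (tagged m) (tagged m').
rewrite mulmx_suml; apply: memv_suml => i _; rewrite -scalemxAl memvZ //.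
exact: (mem_spanf (meetm n) (i := Tagged (fun l : L => hooks (val l) n) i)).
Qed.

(** The endomorphism algebra of F_phi is split: it has a complete system of
    orthogonal idempotents p_l indexed by the types below phi, and for every
    n <= phi the classes of monics from l to n index a basis of
    Hom_G(F_phi, F_n) p_l. *)
Theorem primitive_idempotents : exists p : L -> kmx F,
  [/\ forall l, kinvariant (p l) /\ ksupport phi phi (p l),
      forall l, p l *m p l = p l,
      forall k l, k != l -> p k *m p l = 0,
      \sum_l p l = id_mx &
      forall (l : L) n (orbp := fun m : hooks (val l) n =>
          incl_mx F (val m) *m down l *m p l), ole n phi ->
        indep orbp /\
        forall A, kinvariant A -> ksupport n phi A ->
          A *m p l \in spanf orbp predT].
Proof.
have /choice[q qP] := gram_exists.
have /choice[t tP] l : exists t, t != 0 /\ q l *m q l = t *: q l.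
  by have [t t0 e] := gram_sq (qP l); exists t.
pose p l := (t l)^-1 *: q l.
have t0 l : t l != 0 by case: (tP l).
have qp l : q l = t l *: p l by rewrite scalerA mulfV ?scale1r.
have pp l : p l *m p l = p l.
  rewrite /p -scalemxAl -scalemxAr scalerA; case: (tP l) => _ ->.
  by rewrite scalerA mulfVK.
have pk k l : k != l -> p k *m p l = 0.
  by move=> kl; rewrite /p -scalemxAl -scalemxAr (gram_orth (qP k) (qP l) kl)
    !scaler0.
have ip l : kinvariant (p l) by apply/kinvariantZ/gram_inv/qP.
have sp l : ksupport phi phi (p l) by apply/ksupportZ/gram_supp/qP.
exists p; split=> //.
  (* The q_l span the algebra, as each c_l is q_l up to lower terms. *)
  have spanp A : kinvariant A -> ksupport phi phi A -> A \in spanf p predT.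
    move=> iA sA; have := common_mx_span iA sA; apply/subvP/subv_sumP => l _.
    rewrite -memvE; move: {2}(type_rank l).+1 (ltnSn (type_rank l)) => h.
    elim: h l => // h IH l lh.
    have -> : common_mx l = q l - (q l - common_mx l).
      by rewrite opprB addrCA subrr addr0.
    apply: memvB; first by rewrite qp memvZ // mem_spanf.
    have [qW _] := qP l; move: qW; apply/subvP/subv_sumP => k /andP[kl k'l].
    by rewrite -memvE IH // (leq_trans (type_rank_lt couple kl k'l)).
  have /spanfP[a e] := spanp _ id_mx_inv id_mx_supp.
  rewrite e; apply: eq_bigr => l _.
  have := id_mx_mul (sp l); rewrite e mulmx_suml (bigD1 l) //= big1 => [|k kl].
    by rewrite addr0 -scalemxAl pp => ->.
  by rewrite -scalemxAl pk // scaler0.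
move=> l n orbp nphi.
pose P (m : hooks_to phi n) := lt_type l (tag m).
pose tg (m : hooks (val l) n) : hooks_to phi n :=
  Tagged (fun l : L => hooks (val l) n) m.
have orbE (m : hooks_to phi n) : exists2 b, b != 0 &
    meetm n m *m p (tag m) - b *: meetm n m \in
      spanf (meetm n) (fun m' => lt_type (tag m) (tag m')).
  have [b b0 mb] := meet_mx_gram (qP (tag m)).
  exists ((t (tag m))^-1 * b); first by rewrite mulf_neq0 ?invr_eq0.
  by rewrite -scalerA -scalemxAr -scalerBr memvZ.
split.
  move=> a a0 m.
  have /choice[b bP] (i : hooks (val l) n) : exists b, b != 0 /\
      orbp i - b *: meetm n (tg i) \in spanf (meetm n) P.
    by have [b] := orbE (tg i); exists b.
  have [bm _] := bP m.
  have : a m * b m = 0.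
    apply: (indep_coef (meet_mx_indep couple nphi)
              (P := fun m' => m' != tg m) (i := tg m)); first by rewrite negbK.
    have -> : (a m * b m) *: meetm n (tg m) =
        - (\sum_i a i *: (orbp i - b i *: meetm n (tg i)))
        - \sum_(i | i != m) (a i * b i) *: meetm n (tg i).
      under [X in _ = - X - _]eq_bigr do rewrite scalerBr scalerA.
      by rewrite sumrB a0 sub0r opprK (bigD1 m) //= addrK.
    apply: memvB.
      rewrite memvN; apply: memv_suml => i _; apply: memvZ.
      have [_] := bP i; apply/subvP/spanfS => m'; rewrite /P.
      by apply: contraTneq => ->; rewrite /lt_type eqxx andbF.
    apply: memv_suml => i im; apply/memvZ/mem_spanf.
    apply: contra im => /eqP e.
    exact/eqP/val_inj/(congr1 (@hook_class _ _ _) e).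
  by move/eqP; rewrite mulf_eq0 (negPf bm) orbF => /eqP.
move=> A iA sA; have /spanfP[a ->] := meet_mx_span couple nphi iA sA.
rewrite mulmx_suml; apply: memv_suml => m _; rewrite -scalemxAl memvZ //.
(* Induction on the source of m: if it is not l, then b times [meet_mx m] is the
   product of [meet_mx m] with the idempotent of its source, which p_l
   annihilates, up to lower terms. *)
move: {2}(type_rank (tag m)).+1 (ltnSn (type_rank (tag m))) => h.
elim: h m => // h IH m mh.
have [tm|tm] := eqVneq (tag m) l.
  case: m tm {mh} => k i /= tm; subst k.
  exact: (mem_spanf orbp (i := i)).
have [b b0 mb] := orbE m.
have -> : meetm n m *m p l =
    - b^-1 *: ((meetm n m *m p (tag m) - b *: meetm n m) *m p l).
  rewrite mulmxBl -(mulmxA _ (p (tag m))) pk // mulmx0 sub0r.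
  by rewrite scalerN scaleNr opprK -scalemxAl scalerA mulVf ?scale1r.
rewrite memvZ //; move: mb => /spanfP[c ->]; rewrite mulmx_suml.
apply: memv_suml => m' /andP[lm' nm']; rewrite -scalemxAl memvZ //.
by apply: IH; rewrite (leq_trans (type_rank_lt couple lm' nm')).
Qed.

End EndAlgebra.

(** * Representations: intertwiners, Schur lemma, multiplicities *)

Section LinearMaps.
Variables (V W : vectType rat).
Implicit Types f : 'Hom(V, W).

Lemma lfun_cancel f : lker f == 0%VS -> limg f = fullv ->
  cancel f f^-1%VF /\ cancel f^-1%VF f.
Proof.
move=> kf imf; split; first exact: lker0_lfunK.
by move=> w; rewrite limg_lfunVK // imf memvf.
Qed.

Lemma bij_lfun f : bijective f -> cancel f f^-1%VF /\ cancel f^-1%VF f.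
Proof.
move=> [h fK hK]; apply: lfun_cancel; first exact/lker0P/(can_inj fK).
apply/eqP; rewrite eqEsubv subvf /=; apply/subvP => w _.
by rewrite -(hK w) memv_img ?memvf.
Qed.

End LinearMaps.

Section Reps.
Variable G : groupType.
Implicit Types U V W : representation G.

(** Linear maps that commute with the action of G. *)
Definition intertwiner V W (f : 'Hom(V, W)) : Prop :=
  forall g v, f (ract V g v) = ract W g (f v).

(** Subspaces preserved by the action of G. *)
Definition stable V (X : {vspace V}) : Prop :=
  forall g, (ract V g @: X <= X)%VS.

Lemma stableP V (X : {vspace V}) :
  (forall g v, v \in X -> ract V g v \in X) -> stable X.
Proof. by move=> H g; apply/subvP => _ /memv_imgP[v vX ->]; apply: H. Qed.

Lemma stable_mem V (X : {vspace V}) g v : stable X -> v \in X ->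
  ract V g v \in X.
Proof. by move=> sX vX; apply: (subvP (sX g)); rewrite memv_img. Qed.

Lemma intertw_inv V W (f : 'Hom(V, W)) : bijective f -> intertwiner f ->
  intertwiner f^-1%VF.
Proof.
move=> /bij_lfun[fK Kf] fi g v; apply: (can_inj fK).
by rewrite fi !Kf.
Qed.

Lemma intertw_comp U V W (f : 'Hom(V, W)) (h : 'Hom(U, V)) :
  intertwiner f -> intertwiner h -> intertwiner (f \o h).
Proof. by move=> fi hi g v; rewrite !comp_lfunE hi fi. Qed.

Lemma rep_iso_sym V W : rep_iso V W -> rep_iso W V.
Proof.
move=> [f fb fi]; exists f^-1%VF; last exact: intertw_inv.
by have [fK Kf] := bij_lfun fb; exists f.
Qed.

Lemma stable_lker V W (f : 'Hom(V, W)) : intertwiner f -> stable (lker f).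
Proof.
move=> fi; apply: stableP => g v; rewrite !memv_ker fi => /eqP->.
by rewrite linear0.
Qed.

Lemma stable_limg V W (f : 'Hom(V, W)) (X : {vspace V}) :
  intertwiner f -> stable X -> stable (f @: X).
Proof.
move=> fi sX; apply: stableP => g _ /memv_imgP[v vX ->].
by rewrite -fi memv_img // stable_mem.
Qed.

Lemma stable_full V : stable (fullv : {vspace V}).
Proof. by move=> g; apply: subvf. Qed.

Lemma stable_sum V (I : finType) (X : I -> {vspace V}) :
  (forall i, stable (X i)) -> stable (\sum_i X i)%VS.
Proof.
move=> sX g; rewrite limg_sum; apply/subv_sumP => i _.
by apply: subv_trans (sX i g) _; apply: (sumv_sup i).
Qed.

Lemma schur U W (f : 'Hom(U, W)) : irreducible U -> irreducible W ->
  intertwiner f -> f != 0 -> bijective f.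
Proof.
move=> [_ irrU] [_ irrW] fi f0.
have kf : lker f = 0%VS.
  case: (irrU _ (stable_lker fi)) => // kf; case/eqP: f0; apply/lfunP => u.
  by rewrite zero_lfunE; apply/eqP; rewrite -memv_ker kf memvf.
have imf : limg f = fullv.
  case: (irrW _ (stable_limg fi (@stable_full U))) => // imf.
  by case/eqP: f0; apply/lfunP => u; rewrite zero_lfunE; apply/eqP;
    rewrite -memv0 -imf memv_img ?memvf.
have [fK Kf] := lfun_cancel (introT eqP kf) imf.
by exists f^-1%VF.
Qed.

(** The restriction of a representation to a stable subspace. *)
Section Subrep.
Variables (V : representation G) (X : {vspace V}).
Hypothesis sX : stable X.

Definition subrep_act g : 'End(subvs_of X) :=
  (linfun (vsproj X) \o (ract V g \o linfun vsval))%VF.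

Lemma subrep_actE g u : vsval (subrep_act g u) = ract V g (vsval u).
Proof.
by rewrite !comp_lfunE !lfunE /= vsprojK // stable_mem // subvsP.
Qed.

Lemma subrep_act1 : subrep_act 1%g = \1%VF.
Proof.
by apply/lfunP => u; apply: subvs_inj; rewrite subrep_actE ract1 !id_lfunE.
Qed.

Lemma subrep_actM g h :
  subrep_act (g * h)%g = (subrep_act g \o subrep_act h)%VF.
Proof.
apply/lfunP => u; apply: subvs_inj.
by rewrite comp_lfunE !subrep_actE ractM comp_lfunE.
Qed.

Definition subrep : representation G := Representation subrep_act1 subrep_actM.

Definition subrep_inj : 'Hom(subrep, V) := linfun (vsval : subvs_of X -> V).

Lemma subrep_injE u : subrep_inj u = vsval u. Proof. exact: lfunE. Qed.

Lemma subrep_inj_intertw : intertwiner subrep_inj.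
Proof. by move=> g u; rewrite !subrep_injE; apply: subrep_actE. Qed.

(** A linear retraction of [subrep_inj]; it need not be equivariant. *)
Definition subrep_proj : 'Hom(V, subrep) := linfun (vsproj X).

Lemma subrep_projK v : v \in X -> subrep_inj (subrep_proj v) = v.
Proof. by move=> vX; rewrite subrep_injE lfunE /= vsprojK. Qed.

Lemma subrep_injK : cancel subrep_inj subrep_proj.
Proof. by move=> u; rewrite subrep_injE lfunE /= vsvalK. Qed.

Lemma subrep_irreducible : X != 0%VS ->
  (forall Y : {vspace V}, (Y <= X)%VS -> stable Y -> Y = 0%VS \/ Y = X) ->
  irreducible subrep.
Proof.
move=> X0 simX; split.
  by rewrite dimvf /dim /= dimv_eq0.
move=> Y sY; have sY' : stable (subrep_inj @: Y) :=
  stable_limg subrep_inj_intertw sY.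
have YX : (subrep_inj @: Y <= X)%VS.
  by apply/subvP => _ /memv_imgP[u _ ->]; rewrite subrep_injE subvsP.
have [e|e] := simX _ YX sY'; [left|right].
  apply/eqP; rewrite -subv0; apply/subvP => u uY; rewrite memv0.
  have : subrep_inj u \in (subrep_inj @: Y)%VS by rewrite memv_img.
  rewrite e memv0 => /eqP u0; rewrite -(subrep_injK u) u0 linear0 eqxx //.
apply/eqP; rewrite eqEsubv subvf /=; apply/subvP => u _.
have : subrep_inj u \in (subrep_inj @: Y)%VS.
  by move/vspaceP: e => ->; rewrite subrep_injE subvsP.
by move=> /memv_imgP[w wY /(can_inj subrep_injK)->].
Qed.

End Subrep.

Section DirectSum.
Variables (I : finType) (W : I -> representation G).

Lemma dsum_ofE (h : forall i, W i) i : (dsum_of h : dsum_type W) i = h i.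
Proof. exact: ffunE. Qed.

Lemma dsum_proj_linear i : linear (fun u : dsum_type W => u i).
Proof. by move=> a u v; rewrite dsumD dsumZ. Qed.

(** The projections and the injections of a direct sum. *)
Definition dsum_proj i : 'Hom(dsum W, W i) :=
  linfun (HB.pack (fun u : dsum_type W => u i)
            (GRing.isLinear.Build _ _ _ _ _ (@dsum_proj_linear i))
          : {linear dsum_type W -> W i}).

Lemma dsum_projE i (u : dsum_type W) : dsum_proj i u = u i.
Proof. exact: lfunE. Qed.

Lemma dsum_proj_intertw i : intertwiner (dsum_proj i).
Proof. by move=> g u; rewrite !dsum_projE /= lfunE /= ffunE. Qed.

Lemma dsumP (u v : dsum W) : (forall i, dsum_proj i u = dsum_proj i v) -> u = v.
Proof. by move=> e; apply/ffunP => i; have := e i; rewrite !dsum_projE. Qed.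

Definition dsum_in_fun i (x : W i) : dsum_type W :=
  dsum_of (dfwith (fun=> 0) x).

Lemma dsum_in_linear i : linear (@dsum_in_fun i).
Proof.
move=> a x y; apply: dsumP => j; rewrite !dsum_projE dsumD dsumZ !dsum_ofE.
have [e|ij] := eqVneq i j; first by subst j; rewrite !dfwith_in.
by rewrite !dfwith_out // scaler0 addr0.
Qed.

Definition dsum_in i : 'Hom(W i, dsum W) :=
  linfun (HB.pack (@dsum_in_fun i)
            (GRing.isLinear.Build _ _ _ _ _ (@dsum_in_linear i))
          : {linear W i -> dsum_type W}).

Lemma dsum_proj_in i x : dsum_proj i (dsum_in i x) = x.
Proof. by rewrite dsum_projE lfunE /= dsum_ofE dfwith_in. Qed.

Lemma dsum_proj_in0 i j x : i != j -> dsum_proj j (dsum_in i x) = 0.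
Proof. by move=> ij; rewrite dsum_projE lfunE /= dsum_ofE dfwith_out. Qed.

Lemma dsum_in_intertw i : intertwiner (dsum_in i).
Proof.
move=> g x; apply: dsumP => j; rewrite dsum_proj_intertw.
have [e|ij] := eqVneq i j; first by subst j; rewrite !dsum_proj_in.
by rewrite !dsum_proj_in0 // linear0.
Qed.

End DirectSum.

(** An internal direct sum of stable subspaces is isomorphic to the external
    one. *)
Lemma direct_sum_iso V (I : finType) (X : I -> {vspace V})
    (sX : forall i, stable (X i)) :
  directv (\sum_i X i) -> (\sum_i X i)%VS = fullv ->
  rep_iso V (dsum (fun i => subrep (sX i))).
Proof.
move=> dX fX; apply: rep_iso_sym.
set W := fun i => subrep (sX i).
pose f : 'Hom(dsum W, V) := \sum_i (subrep_inj (sX i) \o dsum_proj W i)%VF.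
have fE u : f u = \sum_i vsval (dsum_proj W i u).
  by rewrite sum_lfunE; apply: eq_bigr => i _; rewrite comp_lfunE subrep_injE.
have kf : lker f == 0%VS.
  rewrite -subv0; apply/subvP => u; rewrite memv_ker memv0 fE => /eqP u0.
  apply/eqP/dsumP => i; rewrite linear0; apply: subvs_inj; rewrite linear0.
  have /directv_sum_independent ind := dX.
  by apply: (ind (fun i => vsval (dsum_proj W i u))) => // j _; apply: subvsP.
have imf : limg f = fullv.
  apply/eqP; rewrite eqEsubv subvf /= -{1}fX; apply/subv_sumP => i _;
    apply/subvP => v vX.
  have -> : v = f (dsum_in W i (subrep_proj (sX i) v)).
    rewrite fE (bigD1 i) //= dsum_proj_in -subrep_injE subrep_projK //.
    rewrite big1 ?addr0 // => j ji.
    by rewrite dsum_proj_in0 1?eq_sym // linear0.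
  by rewrite memv_img ?memvf.
have [fK Kf] := lfun_cancel kf imf.
exists f; first by exists f^-1%VF.
move=> g u; rewrite !fE linear_sum; apply: eq_bigr => i _.
by rewrite dsum_proj_intertw -!subrep_injE subrep_inj_intertw.
Qed.

(** Complete reducibility: every stable subspace has a stable complement. *)
Definition semisimple V : Prop := forall X : {vspace V}, stable X ->
  exists Y : {vspace V}, [/\ stable Y, (X + Y)%VS = fullv &
                            (X :&: Y)%VS = 0%VS].

(** Nonzero stable subspaces that are minimal as such. *)
Definition simple V (X : {vspace V}) : Prop := [/\ X != 0%VS, stable X &
  forall Y : {vspace V}, (Y <= X)%VS -> stable Y -> Y = 0%VS \/ Y = X].

Lemma exists_simple V (Y : {vspace V}) : Y != 0%VS -> stable Y ->
  exists2 Z, simple Z & (Z <= Y)%VS.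
Proof.
move: {2}(\dim Y).+1 (ltnSn (\dim Y)) => h.
elim: h Y => // h IH Y Yh Y0 sY.
have [[Z [ZY sZ Z0 ZnY]]|H] :=
    pselect (exists Z, [/\ (Z <= Y)%VS, stable Z, Z <> 0%VS & Z <> Y]).
  have [|||T sT TZ] := IH Z => //; last by exists T => //; apply: subv_trans ZY.
    rewrite ltnS in Yh; apply: leq_trans Yh.
    by rewrite ltn_neqAle dimvS // andbT (dimv_leqif_eq ZY); apply/eqP.
  exact/eqP.
exists Y => //; split=> // Z ZY sZ.
have [->|Z0] := pselect (Z = 0%VS); first by left.
have [->|ZnY] := pselect (Z = Y); first by right.
by case: H; exists Z.
Qed.

Lemma semisimple_decomposition V : semisimple V ->
  exists (n : nat) (W : 'I_n -> representation G),
    (forall i, irreducible (W i)) /\ rep_iso V (dsum W).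
Proof.
move=> ssV.
(* Direct sums of simple subspaces of dimension at least k, unless the whole
   space has been reached. *)
have H k : exists (n : nat) (X : 'I_n -> {vspace V}),
    [/\ forall i, simple (X i), \dim (\sum_i X i) = (\sum_i \dim (X i))%N &
        (\sum_i X i)%VS = fullv \/ (k <= \dim (\sum_i X i))%N].
  elim: k => [|k [n [X [simX dX [fX|kX]]]]].
  - by exists 0%N, (fun=> 0%VS); split=> [[]//||];
    [rewrite !big_ord0 dimv0|right].
  - by exists n, X; split=> //; left.
  have [fX|nfX] := eqVneq (\sum_i X i)%VS fullv.
    by exists n, X; split=> //; left.
  have sX : stable (\sum_i X i)%VS by apply: stable_sum => i; case: (simX i).
  have [Y [sY sumY capY]] := ssV _ sX.
  have Y0 : Y != 0%VS by apply: contra nfX => /eqP Y0; rewrite -sumY Y0 addv0.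
  have [Z simZ ZY] := exists_simple Y0 sY.
  pose X' (i : 'I_n.+1) := if unlift ord0 i is Some j then X j else Z.
  have X'0 : X' ord0 = Z by rewrite /X' unlift_none.
  have X'l j : X' (lift ord0 j) = X j by rewrite /X' liftK.
  have capZ : (Z :&: \sum_i X i = 0)%VS.
    have : (Z :&: \sum_i X i <= (\sum_i X i) :&: Y)%VS.
      by rewrite subv_cap capvSr (subv_trans (capvSl _ _) ZY).
    by rewrite capY subv0 => /eqP.
  have sumX' : (\sum_i X' i = Z + \sum_i X i)%VS.
    by rewrite big_ord_recl X'0; congr (_ + _)%VS; apply: eq_bigr => i _.
  exists n.+1, X'; split.
  - by move=> i; case: (unliftP ord0 i) => [j|] ->; rewrite ?X'l ?X'0 //;
    exact: simX.
  - rewrite sumX' dimv_disjoint_sum // dX big_ord_recl X'0; congr (_ + _)%N.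
    by apply: eq_bigr => i _; rewrite X'l.
  right; rewrite sumX' dimv_disjoint_sum //.
  by rewrite -add1n leq_add // lt0n dimv_eq0; case: simZ.
have [n [X [simX dX fX]]] := H (\dim (fullv : {vspace V})).+1.
have {}fX : (\sum_i X i)%VS = fullv.
  by case: fX => // /leq_trans/(_ (dimvS (subvf _))); rewrite ltnn.
have sX i : stable (X i) by case: (simX i).
exists n, (fun i => subrep (sX i)); split.
  by move=> i; have [X0 _ Xmin] := simX i; apply: subrep_irreducible.
by apply: direct_sum_iso => //; apply/directvP.
Qed.

(** If U is irreducible with scalar endomorphisms, its multiplicity in a
    completely reducible V is the dimension of Hom_G(U, V): in a decomposition
    of V, the summands isomorphic to U also give a basis F of Hom_G(U, V). *)
Lemma multiplicity_dim_hom U V (J : finType) (c : J -> 'Hom(U, V)) :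
  irreducible U -> semisimple V ->
  (forall f : 'End(U), intertwiner f -> exists a, f = a *: \1%VF) ->
  indep c -> (forall j, intertwiner (c j)) ->
  (forall f : 'Hom(U, V), intertwiner f -> f \in spanf c predT) ->
  has_multiplicity U V #|J|.
Proof.
move=> irrU ssV endU ind_c ic span_c.
have [n [W [irrW VW]]] := semisimple_decomposition ssV.
exists n, W; split=> //; have [th thb thi] := VW.
have [thK Kth] := bij_lfun thb; have thVi := intertw_inv thb thi.
set A := [set i | _].
pose K := {i | i \in A}.
have fP i : exists f : 'Hom(U, W i), i \in A -> bijective f /\ intertwiner f.
  case iA: (i \in A); last by exists 0.
  by move: iA; rewrite inE => /asboolP[f fb fi]; exists f.
pose f i := sval (cid (fP i)).
have fb i : i \in A -> bijective (f i).
  by move=> iA; case: (svalP (cid (fP i)) iA).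
have fi i : i \in A -> intertwiner (f i).
  by move=> iA; case: (svalP (cid (fP i)) iA).
pose F (k : K) : 'Hom(U, V) := (th^-1 \o (dsum_in W (val k) \o f (val k)))%VF.
have thF k u : th (F k u) = dsum_in W (val k) (f (val k) u).
  by rewrite !comp_lfunE Kth.
have iF k : intertwiner (F k).
  apply: intertw_comp thVi _; apply: intertw_comp (@dsum_in_intertw _ _ _) _.
  exact/fi/(valP k).
have ind_F : indep F.
  move=> a a0 k; apply/eqP; apply: contraT => ak; case: (irrU) => + _.
  rewrite dimv_eq0 => /eqP; case; apply/eqP; rewrite -subv0.
  apply/subvP => u _; rewrite memv0.
  have /lfunP/(_ u)/(congr1 th)/(congr1 (dsum_proj W (val k))) := a0.
  rewrite sum_lfunE zero_lfunE !linear0 !linear_sum (bigD1 k) //= big1.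
    rewrite addr0 scale_lfunE !linearZ /= thF dsum_proj_in => /eqP.
    rewrite scaler_eq0 (negPf ak) /= => /eqP e.
    have [fK _] := bij_lfun (fb _ (valP k)).
    by rewrite -(fK u) e linear0.
  move=> k' k'k; rewrite scale_lfunE !linearZ /= thF dsum_proj_in0 ?scaler0 //.
have span_F j : c j \in spanf F predT.
  have aP i : exists a, i \in A -> (dsum_proj W i \o (th \o c j))%VF = a *: f i.
    case iA: (i \in A); last by exists 0.
    set h := (_ \o _)%VF.
    have hi : intertwiner h.
      by apply: intertw_comp (@dsum_proj_intertw _ _ _) _; apply: intertw_comp.
    have fVi := intertw_inv (fb i iA) (fi i iA).
    have [a ea] := endU _ (intertw_comp fVi hi); exists a => _.
    have [_ Kf] := bij_lfun (fb i iA); apply/lfunP => u.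
    have /lfunP/(_ u)/(congr1 (f i)) := ea.
    by rewrite comp_lfunE Kf !scale_lfunE id_lfunE linearZ.
  have /choice[a aE] := aP; apply/spanfP; exists (fun k => a (val k)).
  apply/lfunP => u; apply: (can_inj thK); apply: dsumP => i.
  rewrite sum_lfunE !linear_sum.
  case iA: (i \in A); last first.
    rewrite big1 => [|k _]; last first.
      rewrite scale_lfunE !linearZ /= thF dsum_proj_in0 ?scaler0 //.
      by apply: contraFneq iA => <-; apply: valP.
    set h := (dsum_proj W i \o (th \o c j))%VF.
    have hi : intertwiner h.
      by apply: intertw_comp (@dsum_proj_intertw _ _ _) _; apply: intertw_comp.
    have [h0|h0] := eqVneq h 0.
      by have /lfunP/(_ u) := h0; rewrite !comp_lfunE zero_lfunE.
    by move: iA; rewrite inE => /asboolP; case; exists h => //; apply: schur.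
  rewrite (bigD1 (Sub i iA : K)) //= big1 => [|k ki]; last first.
    rewrite scale_lfunE !linearZ /= thF dsum_proj_in0 ?scaler0 //.
  rewrite addr0 scale_lfunE !linearZ /= thF /= dsum_proj_in.
  by have /lfunP/(_ u) := aE i iA; rewrite !comp_lfunE scale_lfunE.
have -> : #|A| = #|{: K}| by rewrite card_sig; apply: eq_card => i; rewrite inE.
rewrite -(indep_dim ind_F) -(indep_dim ind_c); congr (\dim _); apply/eqP.
rewrite eqEsubv; apply/andP; split; apply/subv_sumP => k _; rewrite -memvE //.
exact: span_c.
Qed.

End Reps.

(** * Kernels as linear maps between the representations F_n *)

Section KernelMaps.
Variables (C : flcategory) (F : C).
Implicit Types (g : aut F) (A B : kmx F) (a b c : otype C).

Lemma binom_actK b g : cancel (@binom_act C F b g) (binom_act g^-1%g).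
Proof. by move=> x; apply: val_inj; apply: sub_actK. Qed.

Lemma binom_actKV b g : cancel (@binom_act C F b g^-1%g) (binom_act g).
Proof. by move=> x; apply: val_inj; apply: sub_actKV. Qed.

Lemma sum_binom b (h : subobj F -> rat) :
  (forall y, stau y != b -> h y = 0) ->
  \sum_y h y = \sum_(y : binom F b) h (val y).
Proof.
move=> h0; rewrite (bigID (fun y => stau y == b)) /= addrC big1 // add0r.
rewrite (reindex_omap (val : binom F b -> subobj F) insub) /=.
  by apply: eq_bigl => y; rewrite valK eqxx (valP y).
by move=> y ty; rewrite insubT.
Qed.

(** The linear map from F_b to F_a with kernel A; only the entries of A at
    pairs of types a and b matter. *)
Definition kmap_fun a b A (u : fun_type F b) : fun_type F a :=
  [ffun x => \sum_(y : binom F b) ent A (val x) (val y) * u y].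

Lemma kmap_linear a b A : linear (@kmap_fun a b A).
Proof.
move=> t u v; apply/ffunP => x; rewrite !ffunE /GRing.scale /= mulr_sumr
  -big_split /=.
by apply: eq_bigr => y _; rewrite !ffunE mulrDr mulrCA.
Qed.

Definition kmap a b A : 'Hom(fun_rep F b, fun_rep F a) :=
  linfun (HB.pack (@kmap_fun a b A)
            (GRing.isLinear.Build _ _ _ _ _ (@kmap_linear a b A))
          : {linear fun_type F b -> fun_type F a}).

Lemma kmapE a b A (u : fun_type F b) (x : binom F a) :
  (kmap a b A u : fun_type F a) x =
  \sum_(y : binom F b) ent A (val x) (val y) * u y.
Proof. by rewrite lfunE ffunE. Qed.

Lemma kmap_mul a b c h A B : ksupport h b A ->
  kmap a c (A *m B) = (kmap a b A \o kmap b c B)%VF.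
Proof.
move=> sA; apply/lfunP => u; rewrite comp_lfunE; apply/ffunP => x.
rewrite !kmapE; under [RHS]eq_bigr do rewrite kmapE mulr_sumr.
rewrite exchange_big /=; apply: eq_bigr => z _; rewrite ent_mul mulr_suml.
rewrite (sum_binom (b := b)) => [|y ty]; first by apply: eq_bigr => y _;
  rewrite mulrA.
suff -> : ent A (val x) y = 0 by rewrite !mul0r.
by apply/eqP; apply: contraR ty => /sA[_ ->].
Qed.

Lemma kmap_sum a b (I : finType) (t : I -> rat) (A : I -> kmx F) :
  kmap a b (\sum_i t i *: A i) = \sum_i t i *: kmap a b (A i).
Proof.
apply/lfunP => u; rewrite sum_lfunE; apply/ffunP => x; rewrite kmapE sum_ffunE.
under [RHS]eq_bigr do rewrite scale_lfunE ffunE kmapE /GRing.scale /= mulr_sumr.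
rewrite exchange_big; apply: eq_bigr => y _; rewrite ent_sum mulr_suml.
by apply: eq_bigr => i _; rewrite entZ mulrA.
Qed.

(** The indicator of a point. *)
Definition delta_fun b (y : binom F b) : fun_rep F b :=
  [ffun z => (z == y)%:R] : fun_type F b.

Lemma kmap_delta a b A (x : binom F a) (y : binom F b) :
  (kmap a b A (delta_fun y) : fun_type F a) x = ent A (val x) (val y).
Proof.
rewrite kmapE (bigD1 y) //= ffunE eqxx mulr1 big1 ?addr0 // => z zy.
by rewrite ffunE (negPf zy) mulr0.
Qed.

Lemma kmap_inj a b A : ksupport a b A -> kmap a b A = 0 -> A = 0.
Proof.
move=> sA A0; apply/entP => x y; rewrite ent0.
apply/eqP; apply: contraT => Axy; have [/eqP tx /eqP ty] := sA _ _ Axy.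
have := kmap_delta A (exist _ x tx : binom F a) (exist _ y ty : binom F b).
by rewrite A0 zero_lfunE ffunE /= => e; rewrite -e eqxx in Axy.
Qed.

Lemma fun_rep_actE b g (u : fun_rep F b) (x : binom F b) :
  (ract (fun_rep F b) g u : fun_type F b) x
    = (u : fun_type F b) (binom_act g^-1%g x).
Proof. by rewrite /= lfunE ffunE. Qed.

Lemma kmap_intertw a b A : kinvariant A -> intertwiner (kmap a b A).
Proof.
move=> iA g u; apply/ffunP => x; rewrite fun_rep_actE !kmapE.
rewrite (reindex (binom_act g)) /=; last first.
  by exists (binom_act g^-1%g) => y _; rewrite ?binom_actK ?binom_actKV.
apply: eq_bigr => y _; rewrite fun_rep_actE binom_actK; congr (_ * _).
by rewrite -[in LHS](binom_actKV g x) iA.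
Qed.

Lemma delta_act b g (y : binom F b) :
  ract (fun_rep F b) g (delta_fun y) = delta_fun (binom_act g y).
Proof.
apply/ffunP => z; rewrite fun_rep_actE !ffunE; congr (_ %:R); congr nat_of_bool.
by apply/eqP/eqP => [<-|->]; rewrite ?binom_actKV ?binom_actK.
Qed.

Lemma delta_sum b (u : fun_type F b) :
  u = \sum_y u y *: (delta_fun y : fun_type F b).
Proof.
apply/ffunP => z; rewrite sum_ffunE (bigD1 z) //= big1 => [|y yz].
  by rewrite !ffunE eqxx addr0 /GRing.scale /= mulr1.
by rewrite !ffunE eq_sym (negPf yz) /GRing.scale /= mulr0.
Qed.

(** Every intertwiner is given by an invariant kernel, namely its values on the
    functions [delta_fun y]. *)
Lemma intertw_kmap a b (f : 'Hom(fun_rep F b, fun_rep F a)) : intertwiner f ->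
  exists A, [/\ kinvariant A, ksupport a b A & f = kmap a b A].
Proof.
move=> fi.
pose k (x y : subobj F) : rat :=
  if insub x is Some x' then if insub y is Some y' then
    (f (delta_fun (y' : binom F b)) : fun_type F a) x' else 0 else 0.
exists (ker_mx k); split.
- move=> g x y; rewrite !entK /k.
  case: (insubP _ x) => [x' tx ex|tx]; last first.
    by rewrite insubF // sub_act_stau; apply: negbTE.
  rewrite insubT ?sub_act_stau // => tgx.
  case: (insubP _ y) => [y' ty ey|ty]; last first.
    by rewrite insubF // sub_act_stau; apply: negbTE.
  rewrite insubT ?sub_act_stau // => tgy.
  have -> : Sub (sub_act g y) tgy = binom_act g y'.
    by apply: val_inj; rewrite /= -ey.
  have -> : Sub (sub_act g x) tgx = binom_act g x'.
    by apply: val_inj; rewrite /= -ex.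
  by rewrite -delta_act fi fun_rep_actE binom_actK.
- move=> x y; rewrite entK /k.
  case: insubP => [x' /eqP-> _|]; last by rewrite eqxx.
  by case: insubP => [y' /eqP-> _|]; last by rewrite eqxx.
apply/lfunP => u; apply/ffunP => x; rewrite kmapE {1}(delta_sum u).
rewrite linear_sum sum_ffunE.
apply: eq_bigr => y _; rewrite linearZ /= ffunE entK /k !valK.
by rewrite /GRing.scale /= mulrC.
Qed.

(** The standard scalar product, which is G-invariant; it makes F_b completely
    reducible. *)
Definition dot b (u v : fun_type F b) : rat := \sum_x u x * v x.

Lemma dot_linear b (u : fun_type F b) : linear_for *%R (dot u).
Proof.
move=> t v w; rewrite /dot mulr_sumr -big_split /=.
by apply: eq_bigr => x _; rewrite !ffunE mulrDr mulrCA.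
Qed.

Lemma dot_sym b (u v : fun_type F b) : dot u v = dot v u.
Proof. by apply: eq_bigr => x _; rewrite mulrC. Qed.

Lemma dot_def b (u : fun_type F b) : dot u u = 0 -> u = 0.
Proof.
move/eqP; rewrite psumr_eq0 => [/allP u0|x _]; last by rewrite -expr2 sqr_ge0.
apply/ffunP => x; rewrite ffunE; apply/eqP; rewrite -sqrf_eq0 expr2.
by have := u0 x; rewrite mem_index_enum; apply.
Qed.

Lemma dot_act b g (u v : fun_type F b) :
  dot (@fun_act C F b g u) (@fun_act C F b g v) = dot u v.
Proof.
rewrite /dot (reindex (binom_act g)) /=; last first.
  by exists (binom_act g^-1%g) => y _; rewrite ?binom_actK ?binom_actKV.
by apply: eq_bigr => x _; rewrite !lfunE /= !ffunE binom_actK.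
Qed.

Lemma fun_rep_semisimple b : semisimple (fun_rep F b).
Proof.
move=> X sX.
have [Y [sumY capY YP]] := orth_complement (@dot_linear b) (@dot_sym b)
  (@dot_def b) X.
exists Y; split=> //; apply: stableP => g v /YP vY; apply/YP => u uX.
rewrite -(dot_act g^-1%g) /=.
have -> : @fun_act C F b g^-1%g (@fun_act C F b g v) = v.
  by rewrite -comp_lfunE -fun_actM mulVg fun_act1 id_lfunE.
by apply: vY; apply: (@stable_mem _ (fun_rep F b) _ g^-1%g).
Qed.

End KernelMaps.

(** * The irreducible constituents *)

Section Decomposition.
Variables (C : flcategory) (F : C) (phi : otype C).
Hypothesis couple : symmetric_couple (tau F) phi.
Local Notation L := (types_le phi).

Let symF : symmetric_type (tau F). Proof. by case: couple. Qed.
Let le_phi : ole phi (tau F). Proof. by case: couple. Qed.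

Lemma card_hooks_refl (l : L) : #|{: hooks (val l) (val l)}| = 1%N.
Proof.
have [x tx] := ole_sub_top (ole_trans (valP l) le_phi).
have h := incl_class_hook (lexx x); rewrite tx in h.
pose m0 : hooks (val l) (val l) := exist _ (incl_class x x) h.
rewrite (eq_card1 (x := m0)) // => m.
rewrite !inE; apply/esym/eqP/val_inj => /=.
exact: (hook_refl_uniq couple (valP l) (valP m) tx).
Qed.

Lemma card_hooks_phi (l : L) : #|{: hooks (val l) phi}| = 1%N.
Proof.
have [m tm] := top_hook couple l; subst l.
rewrite (eq_card1 (x := tagged m)) // => m'.
rewrite !inE; apply/esym/eqP/val_inj.
exact: (hook_phi_uniq couple (valP m') (valP (tagged m))).
Qed.

Lemma card_hooks_nle (l n : otype C) : ~~ ole l n -> #|{: hooks l n}| = 0%N.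
Proof.
move=> ln; apply: eq_card0 => m; case/negP: ln; exact: hook_ole (valP m).
Qed.

Variable p : L -> kmx F.
Hypothesis p_inv : forall l, kinvariant (p l).
Hypothesis p_supp : forall l, ksupport phi phi (p l).
Hypothesis p_idem : forall l, p l *m p l = p l.
Hypothesis p_orth : forall k l, k != l -> p k *m p l = 0.
Hypothesis p_sum : \sum_l p l = id_mx F phi.

(** The basis of Hom_G(F_phi, F_n) p_l given by [primitive_idempotents]. *)
Definition hook_proj_mx (l : L) n (m : hooks (val l) n) : kmx F :=
  incl_mx F (val m) *m down_mx F phi (val l) *m p l.

Hypothesis hook_proj_mx_basis : forall (l : L) n, ole n phi ->
  indep (@hook_proj_mx l n) /\
  forall A, kinvariant A -> ksupport n phi A ->
    A *m p l \in spanf (@hook_proj_mx l n) predT.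

Local Notation V := (fun_rep F phi).

Definition projU l : 'End(V) := kmap phi phi (p l).

Lemma projU_intertw l : intertwiner (projU l). Proof. exact: kmap_intertw. Qed.

Lemma projU_idem l v : projU l (projU l v) = projU l v.
Proof. by rewrite -comp_lfunE -(kmap_mul _ _ _ (@p_supp l)) p_idem. Qed.

Lemma projU_orth k l v : k != l -> projU k (projU l v) = 0.
Proof.
move=> kl; rewrite -comp_lfunE -(kmap_mul _ _ _ (@p_supp k)) p_orth //.
apply/ffunP => x; rewrite kmapE ffunE big1 // => y _.
by rewrite ent0 mul0r.
Qed.

Lemma projU_sum v : \sum_l projU l v = v.
Proof.
apply/ffunP => x; rewrite sum_ffunE.
under eq_bigr do rewrite kmapE.
rewrite exchange_big /=; under eq_bigr do rewrite -mulr_suml -ent_sum p_sum.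
rewrite (bigD1 x) //= entK eqxx (valP x) mul1r big1 ?addr0 // => y yx.
by rewrite entK (inj_eq val_inj) eq_sym (negPf yx) mul0r.
Qed.

Lemma projU_stable l : stable (limg (projU l)).
Proof. exact: stable_limg (projU_intertw l) (@stable_full _ _). Qed.

Lemma projU_id l v : v \in limg (projU l) -> projU l v = v.
Proof. by move=> /memv_imgP[u _ ->]; rewrite projU_idem. Qed.

(** The constituent U_l: the image of p_l in F_phi. *)
Definition repU l : representation (aut F) := subrep (projU_stable l).

Definition Uinj l : 'Hom(repU l, V) := subrep_inj (projU_stable l).

Lemma Uinj_intertw l : intertwiner (Uinj l).
Proof.
exact: subrep_inj_intertw. 
Qed.

Lemma Uinj_inj l : injective (Uinj l).
Proof. exact: (can_inj (@subrep_injK _ _ _ (projU_stable l))). Qed.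

Lemma projU_Uinj l u : projU l (Uinj l u) = Uinj l u.
Proof. by rewrite /Uinj subrep_injE projU_id // subvsP. Qed.

Lemma U_sum : rep_iso V (dsum repU).
Proof.
apply: direct_sum_iso; last first.
  apply/eqP; rewrite eqEsubv subvf /=; apply/subvP => v _.
  by rewrite -(projU_sum v); apply: memv_sumr => l _; rewrite memv_img ?memvf.
apply/directv_sum_independent => u uP u0 l _.
have := congr1 (projU l) u0; rewrite linear0 linear_sum (bigD1 l) //=.
rewrite projU_id ?uP // big1 ?addr0 // => k kl.
by rewrite -(projU_id (uP k isT)) projU_orth // eq_sym.
Qed.

Section Hom.
Variables (l : L) (n : otype C).
Hypothesis n_phi : ole n phi.

(** A basis of Hom_G(U_l, F_n): the restrictions to U_l of the maps of kernel
    [hook_proj_mx m]. *)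
Definition hom_basis (m : hooks (val l) n) : 'Hom(repU l, fun_rep F n) :=
  (kmap n phi (hook_proj_mx m) \o Uinj l)%VF.

Lemma hook_proj_mx_inv (m : hooks (val l) n) : kinvariant (hook_proj_mx m).
Proof.
apply: kinvariant_mul (p_inv l); apply: kinvariant_mul (@down_mx_inv _ _ _ _).
exact: incl_mx_inv couple _.
Qed.

Lemma hook_proj_mx_supp (m : hooks (val l) n) : ksupport n phi (hook_proj_mx m).
Proof.
apply: ksupport_mulmx (@p_supp l).
apply: ksupport_mulmx (@down_mx_supp _ _ _ _).
exact: incl_mx_supp (valP m).
Qed.

Lemma hom_basis_intertw m : intertwiner (hom_basis m).
Proof.
apply: intertw_comp (@Uinj_intertw l); apply: kmap_intertw;
  exact: hook_proj_mx_inv.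
Qed.

Lemma hom_basis_indep : indep hom_basis.
Proof.
have [ind _] := hook_proj_mx_basis l n_phi => a a0; apply: ind.
set A := \sum_i _; have sA : ksupport n phi A.
  by apply: ksupport_sum => m _; apply: hook_proj_mx_supp.
have Ap : A *m p l = A.
  rewrite mulmx_suml; apply: eq_bigr => m _.
  by rewrite -scalemxAl /hook_proj_mx -(mulmxA _ (p l)) p_idem.
apply: (kmap_inj sA); rewrite -Ap (kmap_mul _ _ _ sA).
apply/lfunP => v; rewrite comp_lfunE zero_lfunE.
have [u ->] : exists u, projU l v = Uinj l u.
  exists (subrep_proj (projU_stable l) (projU l v)).
  by rewrite /Uinj subrep_projK // memv_img ?memvf.
have /lfunP/(_ u) := a0; rewrite zero_lfunE sum_lfunE => u0.
rewrite -[RHS]u0 /A kmap_sum sum_lfunE; apply: eq_bigr => m _.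
by rewrite !scale_lfunE comp_lfunE.
Qed.

Lemma hom_basis_span (f : 'Hom(repU l, fun_rep F n)) :
  intertwiner f -> f \in spanf hom_basis predT.
Proof.
move=> fi; pose f' : 'Hom(V, fun_rep F n) :=
  (f \o (subrep_proj (projU_stable l) \o projU l))%VF.
have projE v : Uinj l (subrep_proj (projU_stable l) (projU l v)) = projU l v.
  by rewrite /Uinj subrep_projK // memv_img ?memvf.
have f'i : intertwiner f'.
  apply: intertw_comp fi _ => g v.
  rewrite [LHS]comp_lfunE [(_ \o projU l)%VF v]comp_lfunE.
  by apply: Uinj_inj; rewrite projE projU_intertw Uinj_intertw projE.
have [A [iA sA ef']] := intertw_kmap f'i.
have [_ /(_ A iA sA)/spanfP[a e]] := hook_proj_mx_basis l n_phi.
apply/spanfP; exists a; apply/lfunP => u.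
have -> : f u = f' (projU l (Uinj l u)).
  rewrite !comp_lfunE; congr (f _); apply: Uinj_inj.
  by rewrite projE !projU_Uinj.
rewrite ef' -comp_lfunE -(kmap_mul _ _ _ sA) e kmap_sum !sum_lfunE.
by apply: eq_bigr => m _; rewrite !scale_lfunE comp_lfunE.
Qed.

End Hom.

(** Hom_G(U_l, F_phi) is a line, as there is only one class from l to phi. *)
Lemma hom_U_phi l (f : 'Hom(repU l, V)) : intertwiner f ->
  exists a, f = a *: Uinj l.
Proof.
have phiphi := @ole_refl _ phi.
have ind := hom_basis_indep (l := l) phiphi.
have [m0 m0P] := fintype1 (card_hooks_phi l).
have spanE (h : 'Hom(repU l, V)) : intertwiner h ->
    exists a, h = a *: hom_basis m0.
  move=> /(hom_basis_span phiphi)/spanfP[a ->]; exists (a m0).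
  rewrite (bigD1 m0) //= big1 ?addr0 // => m mm0.
  by rewrite m0P eqxx in mm0.
move=> /spanE[a ->]; have [b eb] := spanE _ (@Uinj_intertw l).
have b0 : b != 0.
  apply: contraTneq (indep_neq0 ind m0) => b0; rewrite negbK.
  by rewrite /hom_basis eb b0 scale0r comp_lfun0r.
by exists (a / b); rewrite eb scalerA divfK.
Qed.

Lemma projU_neq0 l : limg (projU l) != 0%VS.
Proof.
have phiphi := @ole_refl _ phi.
have [m0 _] := fintype1 (card_hooks_phi l).
apply: contraTneq (indep_neq0 (hom_basis_indep (l := l) phiphi) m0) => P0.
rewrite negbK; apply/eqP/lfunP => u; rewrite comp_lfunE zero_lfunE.
suff -> : Uinj l u = 0 by rewrite linear0.
apply/eqP; rewrite -memv0 -P0 /Uinj subrep_injE; exact: subvsP.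
Qed.

(** For Y stable in U_l, the equivariant projection to Y is a scalar on U_l. *)
Lemma U_irreducible l : irreducible (repU l).
Proof.
apply: subrep_irreducible; first exact: projU_neq0.
move=> Y YX sY; have [Z [sZ sumYZ capYZ]] := fun_rep_semisimple sY.
have capZY : (Z :&: Y = 0)%VS by rewrite capvC.
pose f : 'End(V) := daddv_pi Y Z.
have fD v : v = f v + daddv_pi Z Y v.
  by rewrite (daddv_pi_add capYZ) // sumYZ memvf.
have fi : intertwiner f.
  move=> g v; have gY : ract V g (f v) \in Y by rewrite stable_mem ?memv_pi.
  have gZ : ract V g (daddv_pi Z Y v) \in Z by rewrite stable_mem ?memv_pi.
  rewrite {1}(fD v) !linearD /= [f (ract V g (f v))](daddv_pi_id capYZ gY).
  have := fD (ract V g (daddv_pi Z Y v)).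
  rewrite (daddv_pi_id capZY gZ) -[LHS]add0r => /addIr <-.
  by rewrite addr0.
have [a ea] := hom_U_phi (intertw_comp fi (@Uinj_intertw l)).
have fX v : v \in limg (projU l) -> f v = a *: v.
  move=> vX; rewrite -(subrep_projK (projU_stable l) vX).
  by have /lfunP/(_ (subrep_proj (projU_stable l) v)) := ea;
    rewrite comp_lfunE scale_lfunE.
have [->|Y0] := eqVneq Y 0%VS; [by left | right].
have [y yY y0] : exists2 y, y \in Y & y != 0.
  by exists (vpick Y); rewrite ?memv_pick ?vpick0.
have a0 : a != 0.
  apply: contraNneq y0 => a0; have := fX y (subvP YX _ yY).
  by rewrite [LHS](daddv_pi_id capYZ yY) a0 scale0r => ->.
apply/eqP; rewrite eqEsubv YX /=; apply/subvP => v /fX fv.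
have -> : v = a^-1 *: f v by rewrite fv scalerA mulVf ?scale1r.
by rewrite memvZ // memv_pi.
Qed.

Lemma U_end l (f : 'End(repU l)) : intertwiner f -> exists a, f = a *: \1%VF.
Proof.
move=> fi; have [a ea] := hom_U_phi (intertw_comp (@Uinj_intertw l) fi).
exists a; apply/lfunP => u; apply: Uinj_inj.
have /lfunP/(_ u) := ea; rewrite comp_lfunE !scale_lfunE id_lfunE => ->.
by rewrite linearZ.
Qed.

Lemma U_noniso l n : l <> n -> ~ rep_iso (repU l) (repU n).
Proof.
move=> /eqP ln [f fb fi].
have [a ea] := hom_U_phi (intertw_comp (@Uinj_intertw n) fi).
have [fK _] := bij_lfun fb; case: (U_irreducible l) => /eqP[].
apply/eqP; rewrite dimv_eq0 -subv0; apply/subvP => u _; rewrite memv0.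
suff : f u = 0 by move=> fu; rewrite -(fK u) fu linear0.
apply: Uinj_inj; rewrite linear0 -projU_Uinj.
have /lfunP/(_ u) := ea; rewrite comp_lfunE scale_lfunE => ->.
by rewrite -projU_Uinj -linearZ projU_orth // eq_sym.
Qed.

Lemma U_multiplicity l n : ole n phi ->
  has_multiplicity (repU l) (fun_rep F n) #|{: hooks (val l) n}|.
Proof.
move=> n_phi; apply: (multiplicity_dim_hom (c := @hom_basis l n)).
- exact: U_irreducible.
- exact: fun_rep_semisimple.
- exact: U_end.
- exact: hom_basis_indep.
- exact: hom_basis_intertw.
exact: hom_basis_span.
Qed.

End Decomposition.

Local Close Scope ring_scope.

Theorem theorem7 (C : flcategory) (F : C) (Phi phi : otype C)
    (tauF : tau F = Phi) (symPhi : symmetric_type Phi)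
    (couple : symmetric_couple Phi phi) :
  exists U : types_le phi -> representation (aut F),
    [/\ forall l : types_le phi, irreducible (U l),
        forall l n : types_le phi, l <> n -> ~ rep_iso (U l) (U n),
        rep_iso (fun_rep F phi) (dsum U),
        forall l n : types_le phi,
          has_multiplicity (U l) (fun_rep F (val n)) #|{: hooks (val l) (val n)}|
      & (forall l : types_le phi,
           has_multiplicity (U l) (fun_rep F (val l)) 1) /\
        (forall l n : types_le phi, ~~ ole (val l) (val n) ->
           has_multiplicity (U l) (fun_rep F (val n)) 0)].
Proof.
subst Phi.
have [p [p_is p_idem p_orth p_sum p_basis]] := primitive_idempotents couple.
have p_inv l : kinvariant (p l) by case: (p_is l).
have p_supp l : ksupport phi phi (p l) by case: (p_is l).
have mult (l n : types_le phi) :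
    has_multiplicity (repU p_inv l) (fun_rep F (val n))
      #|{: hooks (val l) (val n)}|.
  exact: (U_multiplicity couple p_inv p_supp p_idem p_basis l (valP n)).
exists (repU p_inv); split=> //.
- exact: U_irreducible.
- exact: U_noniso.
- exact: U_sum.
split=> [l|l n ln]; first by rewrite -(card_hooks_refl couple l).
by rewrite -(card_hooks_nle ln).
Qed.
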